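(* Let $R$ be a unital ring, $\mathrm{L}$ a length function on left $R$-modules, $\Gamma$ a discrete amenable group, $\Sigma=\{\sigma_i:\Gamma\to \mathrm{Sym}(d_i)\}_{i\in J}$ a sofic approximation net for $\Gamma$, and $\omega$ a free ultrafilter on $J$. For any locally $\mathrm{L}$-finite $R\Gamma$-module $\mathcal{M}$ and any $\mathscr{A}\in \mathscr{F}(\mathcal{M})$, we have $$\mathrm{mL}_{\Sigma, \omega}(\mathscr{A}|\mathcal{M})=\mathrm{mL}(\mathscr{A}).$$ In particular, for any $R\Gamma$-modules $\mathcal{M}_1\subseteq \mathcal{M}_2$ such that $\mathcal{M}_2$ is locally $\mathrm{L}$-finite, we have $$\mathrm{mL}_{\Sigma, \omega}(\mathcal{M}_1|\mathcal{M}_2)=\mathrm{mL}(\mathcal{M}_1).$$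
   Context: All modules are left modules. Write $[d]=\{1,\dots,d\}$, $\mathrm{Sym}(d)$ for the permutation group of $[d]$, $\mathcal{F}(\Gamma)$ for the set of all finite subsets of $\Gamma$, and $\mathscr{F}(\mathscr{M})$ for the set of all finitely generated $R$-submodules of an $R$-module $\mathscr{M}$. Length function: an assignment $\mathscr{M}\mapsto \mathrm{L}(\mathscr{M})\in \mathbb{R}_{\ge 0}\cup\{+\infty\}$ on $R$-modules such that $\mathrm{L}(0)=0$; $\mathrm{L}(\mathscr{M}_2)=\mathrm{L}(\mathscr{M}_1)+\mathrm{L}(\mathscr{M}_3)$ for every short exact sequence $0\to \mathscr{M}_1\to\mathscr{M}_2\to\mathscr{M}_3\to 0$; and $\mathrm{L}(\mathscr{M})=\sup_{\mathscr{N}\in \mathscr{F}(\mathscr{M})}\mathrm{L}(\mathscr{N})$. A module is locally $\mathrm{L}$-finite if each of its finitely generated $R$-submodules has finite $\mathrm{L}$-length. $\Gamma$ is amenable if for any nonempty $K\in\mathcal{F}(\Gamma)$ and $\delta>0$ there is a nonempty $F\in\mathcal{F}(\Gamma)$ with $|KF\setminus F|<\delta|F|$. Amenable groups are sofic. Sofic approximation net: a net of maps $\sigma_i:\Gamma\to\mathrm{Sym}(d_i)$, indexed by a directed set $J$, such that $\lim_i |\{v\in[d_i]:\sigma_{i,s}\sigma_{i,t}(v)=\sigma_{i,st}(v)\}|/d_i=1$ for all $s,t\in \Gamma$; $\lim_i|\{v\in[d_i]:\sigma_{i,s}(v)\ne\sigma_{i,t}(v)\}|/d_i=1$ for all distinct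 $s,t\in\Gamma$; and $\lim_i d_i=+\infty$. An ultrafilter $\omega$ on $J$ is free if $\{i\in J:i\ge j\}\in\omega$ for every $j\in J$. Sofic mean length: let $\mathcal{M}_1\subseteq\mathcal{M}_2$ be $R\Gamma$-modules with $\mathcal{M}_1$ locally $\mathrm{L}$-finite, $\mathscr{A}\in\mathscr{F}(\mathcal{M}_1)$, $\mathscr{B}\in\mathscr{F}(\mathcal{M}_2)$, $F\in\mathcal{F}(\Gamma)$, and $\sigma:\Gamma\to\mathrm{Sym}(d)$ a map; write $sv=\sigma_s(v)$. For $x\in\mathcal{M}_2$, $v\in[d]$, let $\delta_vx\in\mathcal{M}_2^d$ take value $x$ at $v$ and $0$ elsewhere. Let $\mathscr{M}(\mathscr{B},F,\sigma)$ be the $R$-submodule of $\mathcal{M}_2^d$ generated by $\delta_vb-\delta_{sv}sb$ for $v\in[d]$, $b\in\mathscr{B}$, $s\in F$, and let $\mathscr{M}(\mathscr{A},\mathscr{B},F,\sigma)$ be the image of $\mathscr{A}^d$ in $\mathcal{M}_2^d/\mathscr{M}(\mathscr{B},F,\sigma)$. Define $\mathrm{mL}_{\Sigma,\omega}(\mathscr{A}|\mathscr{B},F)=\lim_{i\to\omega}\mathrm{L}(\mathscr{M}(\mathscr{A},\mathscr{B},F,\sigma_i))/d_i$, $\mathrm{mL}_{\Sigma,\omega}(\mathscr{A}|\mathscr{B})=\inf_{F\in\mathcal{F}(\Gamma)}\mathrm{mL}_{\Sigma,\omega}(\mathscr{A}|\mathscr{B},F)$, $\mathrm{mL}_{\Sigma,\omega}(\mathscr{A}|\mathcal{M}_2)=\inf_{\mathscr{B}\in\mathscr{F}(\mathcal{M}_2)}\mathrm{mL}_{\Sigma,\omega}(\mathscr{A}|\mathscr{B})$,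 $\mathrm{mL}_{\Sigma,\omega}(\mathcal{M}_1|\mathcal{M}_2)=\sup_{\mathscr{A}\in\mathscr{F}(\mathcal{M}_1)}\mathrm{mL}_{\Sigma,\omega}(\mathscr{A}|\mathcal{M}_2)$. Amenable mean length: for a locally $\mathrm{L}$-finite $R\Gamma$-module $\mathcal{M}$, $\mathscr{A}\in\mathscr{F}(\mathcal{M})$ and $F\in\mathcal{F}(\Gamma)$, put $\mathscr{A}^F=\sum_{s\in F}s^{-1}\mathscr{A}$. The limit of $\mathrm{L}(\mathscr{A}^F)/|F|$ as $F$ becomes more and more left invariant exists and equals $\inf_{F\in\mathcal{F}(\Gamma)\setminus\{\emptyset\}}\mathrm{L}(\mathscr{A}^F)/|F|$; it is denoted $\mathrm{mL}(\mathscr{A})$. (The limit being $\mathrm{mL}(\mathscr{A})$ means: for each $\varepsilon>0$ there are a nonempty $K\in\mathcal{F}(\Gamma)$ and $\delta>0$ with $|\mathrm{L}(\mathscr{A}^F)/|F|-\mathrm{mL}(\mathscr{A})|<\varepsilon$ for all nonempty $F\in\mathcal{F}(\Gamma)$ with $|KF\setminus F|<\delta|F|$.) Put $\mathrm{mL}(\mathcal{M})=\sup_{\mathscr{A}\in\mathscr{F}(\mathcal{M})}\mathrm{mL}(\mathscr{A})$. *)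

(* Defs.v *)
From HB Require Import structures.
From mathcomp Require Import all_boot all_order all_algebra.
From mathcomp Require Import perm finmap.
From mathcomp.multinomials Require monalg.

Set Implicit Arguments.
Unset Strict Implicit.
Unset Printing Implicit Defensive.

Import Order.TTheory GRing.Theory Num.Theory.

Local Open Scope ring_scope.

(* The group ring R Gamma is carried by the finitely supported functions of
   multinomials' monalg.  The ring structure there does not apply: its
   exponents form a monoid without nontrivial units. *)
Module GroupRing.
Import monalg.

Section GroupRing.
Variables (R : pzRingType) (Gamma : groupType).

Definition group_ring : Type := {malg R[Gamma]}.

#[export] HB.instance Definition _ := GRing.Zmodule.on group_ring.

Definition monom (s : Gamma) (r : R) : group_ring := mkmalgU s r.

Implicit Types (g h : group_ring) (s t : Gamma).

Definition conv_term g h s t : group_ring :=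
  monom (s * t)%g (mcoeff s g * mcoeff t h).

Definition one : group_ring := monom 1%g 1.

Definition mul g h : group_ring :=
  \sum_(s <- msupp g) \sum_(t <- msupp h) conv_term g h s t.

Lemma mulw (d1 d2 : {fset Gamma}) g h :
  (msupp g `<=` d1)%fset -> (msupp h `<=` d2)%fset ->
  mul g h = \sum_(s <- d1) \sum_(t <- d2) conv_term g h s t.
Proof.
move=> le_d1 le_d2; rewrite /mul (big_fset_incl _ le_d1) /=.
  apply/eq_bigr=> s _; apply/big_fset_incl => // t _ /mcoeff_outdom ht.
  by rewrite /conv_term ht mulr0 /monom monalgU0.
move=> s _ /mcoeff_outdom gs.
by rewrite big1 // => t _; rewrite /conv_term gs mul0r /monom monalgU0.
Qed.

Lemma mul_monom s t (a b : R) :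
  mul (monom s a) (monom t b) = monom (s * t)%g (a * b).
Proof.
by rewrite (mulw msuppU_le msuppU_le) !big_seq_fset1 /conv_term !mcoeffUU.
Qed.

Lemma mulDl : left_distributive mul +%R.
Proof.
move=> g1 g2 h; have le2 := fsubset_refl (msupp h).
rewrite (mulw (msuppD_le g1 g2) le2) (mulw (fsubsetUl _ (msupp g2)) le2).
rewrite (mulw (fsubsetUr (msupp g1) _) le2) -big_split; apply/eq_bigr=> s _ /=.
rewrite -big_split; apply/eq_bigr=> t _ /=.
by rewrite /conv_term mcoeffD mulrDl /monom monalgUD.
Qed.

Lemma mulDr : right_distributive mul +%R.
Proof.
move=> g h1 h2; have le1 := fsubset_refl (msupp g).
rewrite (mulw le1 (msuppD_le h1 h2)) (mulw le1 (fsubsetUl _ (msupp h2))).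
rewrite (mulw le1 (fsubsetUr (msupp h1) _)) -big_split; apply/eq_bigr=> s _ /=.
rewrite -big_split; apply/eq_bigr=> t _ /=.
by rewrite /conv_term mcoeffD mulrDr /monom monalgUD.
Qed.

Lemma mul0g : left_zero 0 mul.
Proof. by move=> g; apply: (@addrI _ (mul 0 g)); rewrite -mulDl !addr0. Qed.

Lemma mulg0 : right_zero 0 mul.
Proof. by move=> g; apply: (@addrI _ (mul g 0)); rewrite -mulDr !addr0. Qed.

Lemma sum_monom g : g = \sum_(s <- msupp g) monom s (mcoeff s g).
Proof. exact: monalgE. Qed.

Lemma mul_suml (I : Type) (r : seq I) (F : I -> group_ring) h :
  mul (\sum_(i <- r) F i) h = \sum_(i <- r) mul (F i) h.
Proof. exact: (big_morph (mul^~ h) (fun _ _ => mulDl _ _ _) (mul0g h)). Qed.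

Lemma mul_sumr (I : Type) (r : seq I) (F : I -> group_ring) g :
  mul g (\sum_(i <- r) F i) = \sum_(i <- r) mul g (F i).
Proof. exact: (big_morph (mul g) (fun _ _ => mulDr _ _ _) (mulg0 g)). Qed.

Lemma mulA : associative mul.
Proof.
move=> g1 g2 g3; rewrite (sum_monom g1) !mul_suml; apply/eq_bigr=> s _.
rewrite (sum_monom g2) !(mul_suml, mul_sumr); apply/eq_bigr=> t _.
rewrite (sum_monom g3) !mul_sumr; apply/eq_bigr=> u _.
by rewrite !mul_monom mulrA mulgA.
Qed.

Lemma mul1 : left_id one mul.
Proof.
move=> g; rewrite (sum_monom g) mul_sumr; apply/eq_bigr=> s _.
by rewrite mul_monom mul1r mul1g.
Qed.

Lemma mulr_1 : right_id one mul.
Proof.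
move=> g; rewrite (sum_monom g) mul_suml; apply/eq_bigr=> s _.
by rewrite mul_monom mulr1 mulg1.
Qed.

#[export] HB.instance Definition _ := GRing.Zmodule_isPzRing.Build group_ring
  mulA mul1 mulr_1 mulDl mulDr.

Lemma monomM s t (a b : R) : monom s a * monom t b = monom (s * t)%g (a * b).
Proof. exact: mul_monom. Qed.

Lemma monomD s (a b : R) : monom s (a + b) = monom s a + monom s b.
Proof. exact: monalgUD. Qed.

Lemma monom1 : monom 1%g 1 = 1. Proof. by []. Qed.

End GroupRing.

Module Exports. HB.reexport. End Exports.
End GroupRing.
Export GroupRing.Exports.
Notation group_ring := GroupRing.group_ring.

From mathcomp Require Import all_classical all_reals.
From mathcomp Require Import ereal topology normedtype sequences.

Import numFieldNormedType.Exports.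

Local Open Scope classical_set_scope.

Section Submodules.
Variables (R : pzRingType) (M : lmodType R).

Definition submod (N : submodClosed M) : Type := {x : M | x \in N}.

HB.instance Definition _ (N : submodClosed M) := SubChoice.on (submod N).
HB.instance Definition _ (N : submodClosed M) :=
  [SubChoice_isSubLmodule of submod N by <:].

Definition gen_pred (S : set M) : M -> bool :=
  fun x => `[< forall N : submodClosed M, (forall y, S y -> y \in N) ->
                 x \in N >].

Lemma gen_submod_closed (S : set M) : subsemimod_closed (gen_pred S).
Proof.
split; first split.
- by apply/asboolP=> N _; apply: rpred0.
- move=> x y /asboolP Sx /asboolP Sy; apply/asboolP=> N SN.
  by apply: rpredD; [apply: Sx | apply: Sy].
- move=> a x /asboolP Sx; apply/asboolP=> N SN.
  by apply: rpredZ; apply: Sx.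
Qed.

HB.instance Definition _ (S : set M) :=
  GRing.isSubmodClosed.Build R M (gen_pred S) (gen_submod_closed S).

Definition gen_submod (S : set M) : submodClosed M :=
  GRing.SubmodClosed.clone R M (gen_pred S) _.

Definition fin_gen (N : submodClosed M) : Prop :=
  exists s : seq M, forall x, (x \in N) = (x \in gen_submod [set` s]).

Definition pow_pred (N : submodClosed M) (d : nat) : {ffun 'I_d -> M} -> bool :=
  fun f => [forall v, f v \in N].

Lemma pow_submod_closed (N : submodClosed M) (d : nat) :
  subsemimod_closed (pow_pred N (d := d)).
Proof.
split; first split.
- by apply/forallP=> v; rewrite ffunE rpred0.
- move=> f g /forallP Nf /forallP Ng; apply/forallP=> v.
  by rewrite ffunE rpredD.
- by move=> a f /forallP Nf; apply/forallP=> v; rewrite ffunE rpredZ.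
Qed.

HB.instance Definition _ (N : submodClosed M) (d : nat) :=
  GRing.isSubmodClosed.Build R {ffun 'I_d -> M} (pow_pred N (d := d))
    (pow_submod_closed N d).

Definition pow_submod (N : submodClosed M) (d : nat) :
    submodClosed {ffun 'I_d -> M} :=
  GRing.SubmodClosed.clone R {ffun 'I_d -> M} (pow_pred N (d := d)) _.

End Submodules.

Section ImageSubmodule.
Variables (R : pzRingType) (U V : lmodType R) (f : {linear U -> V}).

Definition image_pred (N : submodClosed U) : V -> bool :=
  fun y => `[< exists2 x, x \in N & f x = y >].

Lemma image_submod_closed (N : submodClosed U) :
  subsemimod_closed (image_pred N).
Proof.
split; first split.
- by apply/asboolP; exists 0; [apply: rpred0 | apply: linear0].
- move=> _ _ /asboolP[x Nx <-] /asboolP[y Ny <-]; apply/asboolP.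
  by exists (x + y); [apply: rpredD | apply: linearD].
- move=> a _ /asboolP[x Nx <-]; apply/asboolP.
  by exists (a *: x); [apply: rpredZ | rewrite linearZ].
Qed.

HB.instance Definition _ (N : submodClosed U) :=
  GRing.isSubmodClosed.Build R V (image_pred N) (image_submod_closed N).

Definition image_submod (N : submodClosed U) : submodClosed V :=
  GRing.SubmodClosed.clone R V (image_pred N) _.

End ImageSubmodule.

Section QuotientModule.
Import ring_quotient generic_quotient.
Local Open Scope quotient_scope.
Variables (R : pzRingType) (M : lmodType R) (N : submodClosed M).

Lemma submod_oppr : oppr_closed N.
Proof. by move=> x Nx; rewrite -scaleN1r rpredZ. Qed.

Definition submod_zmod : zmodClosed M :=
  HB.pack_for (zmodClosed M) (GRing.SubmodClosed.sort N)
    (GRing.isOppClosed.Build M N submod_oppr).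

Definition quot_mod : Type := Quotient.quot submod_zmod.

HB.instance Definition _ := GRing.Zmodule.on quot_mod.

Definition quot_proj (x : M) : quot_mod := \pi_(Quotient.quot submod_zmod) x.

Lemma quot_proj_zmod : zmod_morphism quot_proj.
Proof. by move=> x y; rewrite /quot_proj raddfB. Qed.

HB.instance Definition _ :=
  GRing.isZmodMorphism.Build M quot_mod quot_proj quot_proj_zmod.

Lemma quot_projP x y : reflect (quot_proj x = quot_proj y) (x - y \in N).
Proof. by rewrite (Quotient.idealrBE submod_zmod x y); apply: eqP. Qed.

Definition quot_repr (x : quot_mod) : M := repr (x : Quotient.quot submod_zmod).

Lemma quot_reprK : cancel quot_repr quot_proj.
Proof. by move=> x; apply: reprK. Qed.

Definition quot_scale (a : R) (x : quot_mod) : quot_mod :=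
  quot_proj (a *: quot_repr x).

Lemma quot_scale_proj a x : quot_scale a (quot_proj x) = quot_proj (a *: x).
Proof.
by apply/quot_projP; rewrite -scalerBr rpredZ //; apply/quot_projP/quot_reprK.
Qed.

Lemma quot_scaleA a b x : quot_scale a (quot_scale b x) = quot_scale (a * b) x.
Proof. by rewrite -[x]quot_reprK !quot_scale_proj scalerA. Qed.

Lemma quot_scale1 : left_id 1 quot_scale.
Proof. by move=> x; rewrite -[x]quot_reprK quot_scale_proj scale1r. Qed.

Lemma quot_scaleDr : right_distributive quot_scale +%R.
Proof.
move=> a x y; rewrite -[x]quot_reprK -[y]quot_reprK -raddfD !quot_scale_proj.
by rewrite scalerDr raddfD.
Qed.

Lemma quot_scaleDl x : {morph quot_scale^~ x : a b / a + b}.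
Proof.
by move=> a b; rewrite -[x]quot_reprK !quot_scale_proj scalerDl raddfD.
Qed.

HB.instance Definition _ := GRing.Zmodule_isLmodule.Build R quot_mod
  quot_scaleA quot_scale1 quot_scaleDr quot_scaleDl.

Lemma quot_proj_scalable : scalable quot_proj.
Proof. by move=> a x; rewrite -quot_scale_proj. Qed.

HB.instance Definition _ :=
  GRing.isScalable.Build R M quot_mod *:%R quot_proj quot_proj_scalable.

End QuotientModule.

Section RestrictionOfScalars.
Variables (R : pzRingType) (Gamma : groupType).

Definition restr (M : lmodType (group_ring R Gamma)) : Type := M.

Variable M : lmodType (group_ring R Gamma).

HB.instance Definition _ := GRing.Zmodule.on (restr M).

Definition restr_scale (r : R) (x : restr M) : restr M :=
  GroupRing.monom 1%g r *: (x : M).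

Lemma restr_scaleA a b x :
  restr_scale a (restr_scale b x) = restr_scale (a * b) x.
Proof. by rewrite /restr_scale scalerA GroupRing.monomM mulg1. Qed.

Lemma restr_scale1 : left_id 1 restr_scale.
Proof. by move=> x; apply: scale1r. Qed.

Lemma restr_scaleDr : right_distributive restr_scale +%R.
Proof. by move=> a x y; apply: scalerDr. Qed.

Lemma restr_scaleDl x : {morph restr_scale^~ x : a b / a + b}.
Proof. by move=> a b; rewrite /restr_scale GroupRing.monomD scalerDl. Qed.

HB.instance Definition _ := GRing.Zmodule_isLmodule.Build R (restr M)
  restr_scaleA restr_scale1 restr_scaleDr restr_scaleDl.

Definition gact (s : Gamma) (x : restr M) : restr M :=
  GroupRing.monom s 1 *: (x : M).

End RestrictionOfScalars.

Section Length.
Variables (K : realType) (R : pzRingType).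
Local Open Scope ereal_scope.

(* L is given on module structures; its invariance under isomorphism follows
   from length_zero and length_exact. *)
Record length_function (L : lmodType R -> \bar K) : Prop := LengthFunction {
  length_ge0 : forall M : lmodType R, 0 <= L M;
  length_zero : forall M : lmodType R, (forall x : M, x = 0%R) -> L M = 0;
  length_exact : forall (M1 M2 M3 : lmodType R)
      (f : {linear M1 -> M2}) (g : {linear M2 -> M3}),
    injective f ->
    (forall y : M2, g y = 0%R <-> exists x : M1, f x = y) ->
    (forall z : M3, exists y : M2, g y = z) ->
    L M2 = L M1 + L M3;
  length_sup : forall M : lmodType R,
    L M = ereal_sup [set L (submod N) | N in [set N : submodClosed M | fin_gen N]]
}.

Definition locally_finite (L : lmodType R -> \bar K) (M : lmodType R) : Prop :=
  forall N : submodClosed M, fin_gen N -> L (submod N) < +oo.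

End Length.

Section Amenable.
Variables (K : realType) (Gamma : groupType).

Definition left_invariant (E : {fset Gamma}) (delta : K) (F : {fset Gamma}) :=
  (#|` ([fset (s * t)%g | s in E, t in F] `\` F)%fset|%:R
     < delta * #|` F|%:R).

Definition amenable : Prop :=
  forall (E : {fset Gamma}) (delta : K), E != fset0 -> 0 < delta ->
  exists2 F : {fset Gamma}, F != fset0 & left_invariant E delta F.

(* The filter along which F becomes more and more left invariant *)
Definition invariance_filter : set_system {fset Gamma} :=
  filter_from [set p : {fset Gamma} * K | p.1 != fset0 /\ 0 < p.2]
    (fun p => [set F | F != fset0 /\ left_invariant p.1 p.2 F]).

End Amenable.

Arguments invariance_filter K Gamma : clear implicits.

Section Sofic.
Variables (K : realType) (Gamma : groupType).

Record directed (J : Type) (le : J -> J -> Prop) : Prop := Directed {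
  directed_ex : exists _ : J, True;
  directed_refl : forall i, le i i;
  directed_trans : forall j i k, le i j -> le j k -> le i k;
  directed_ub : forall i j, exists2 k, le i k & le j k
}.

Definition tails (J : Type) (le : J -> J -> Prop) : set_system J :=
  filter_from setT (fun j => [set i | le j i]).

Definition free_ultrafilter (J : Type) (le : J -> J -> Prop)
    (omega : set_system J) : Prop :=
  UltraFilter omega /\ forall j, omega [set i | le j i].

(* The composition sigma_s sigma_t is spelled out pointwise: the
   product of 'S_d composes in the opposite order. *)
Record sofic_net (J : Type) (le : J -> J -> Prop) (d : J -> nat)
    (sigma : forall i, Gamma -> 'S_(d i)) : Prop := SoficNet {
  sofic_gt0 : forall i, (0 < d i)%N;
  sofic_mul : forall s t : Gamma,
    (#|[set v | sigma i s (sigma i t v) == sigma i (s * t)%g v]%SET|%:R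
       / (d i)%:R : K) @[i --> tails le] --> (1 : K);
  sofic_free : forall s t : Gamma, s != t ->
    (#|[set v | sigma i s v != sigma i t v]%SET|%:R
       / (d i)%:R : K) @[i --> tails le] --> (1 : K);
  sofic_dim : d i @[i --> tails le] --> \oo
}.

End Sofic.

Section SoficMeanLength.
Variables (K : realType) (R : pzRingType) (L : lmodType R -> \bar K).
Variables (Gamma : groupType) (M : lmodType (group_ring R Gamma)).
Implicit Types (A B : submodClosed (restr M)) (F : {fset Gamma}).

Definition delta (d : nat) (v : 'I_d) (x : restr M) : {ffun 'I_d -> restr M} :=
  [ffun w => if w == v then x else 0].

Definition sofic_rel B F (d : nat) (sigma : Gamma -> 'S_d) :
    submodClosed {ffun 'I_d -> restr M} :=
  gen_submod [set y | exists v : 'I_d, exists b : restr M, exists s : Gamma,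
    [/\ b \in B, s \in F & y = delta v b - delta (sigma s v) (gact s b)]].

Definition sofic_mod A B F (d : nat) (sigma : Gamma -> 'S_d) :
    submodClosed (quot_mod (sofic_rel B F sigma)) :=
  image_submod (quot_proj (sofic_rel B F sigma)) (pow_submod A d).

Variables (J : Type) (d : J -> nat) (sigma : forall i, Gamma -> 'S_(d i)).
Variable omega : set_system J.
Local Open Scope ereal_scope.

Definition sofic_mL_fin A B F : \bar K :=
  lim ((L (submod (sofic_mod A B F (sigma i))) * ((d i)%:R^-1)%:E)
         @[i --> omega]).

Definition sofic_mL_rel A B : \bar K :=
  ereal_inf [set sofic_mL_fin A B F | F in [set: {fset Gamma}]].

Definition sofic_mL_sub A : \bar K :=
  ereal_inf [set sofic_mL_rel A B | B in [set B | fin_gen B]].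

(* mL_{Sigma, omega}(M1 | M): finitely generated R-submodules of M1 are the
   finitely generated R-submodules of M contained in M1. *)
Definition sofic_mL (M1 : submodClosed M) : \bar K :=
  ereal_sup [set sofic_mL_sub A
    | A in [set A : submodClosed (restr M) |
              fin_gen A /\ forall x : M, (x : restr M) \in A -> x \in M1]].

End SoficMeanLength.

Section AmenableMeanLength.
Variables (K : realType) (R : pzRingType) (L : lmodType R -> \bar K).
Variables (Gamma : groupType) (M : lmodType (group_ring R Gamma)).
Local Open Scope ereal_scope.

Definition translates (A : submodClosed (restr M)) (F : {fset Gamma}) :
    submodClosed (restr M) :=
  gen_submod [set y | exists s : Gamma, exists a : restr M,
    [/\ s \in F, a \in A & y = gact s^-1%g a]].

Definition mL_sub (A : submodClosed (restr M)) : \bar K :=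
  lim ((L (submod (translates A F)) * (#|` F|%:R^-1)%:E)
         @[F --> invariance_filter K Gamma]).

Definition mL : \bar K :=
  ereal_sup [set mL_sub A | A in [set A | fin_gen A]].

End AmenableMeanLength.

(* Main.v *)
From HB Require Import structures.
Require Import Defs.
From mathcomp Require Import all_boot all_order all_algebra perm finmap.
From mathcomp Require Import all_classical all_reals ereal topology normedtype.
From mathcomp Require Import sequences.

Set Implicit Arguments.
Unset Strict Implicit.
Unset Printing Implicit Defensive.

Import Order.TTheory GRing.Theory Num.Theory.
Import numFieldNormedType.Exports.

Local Open Scope ring_scope.

(** Fix a finitely generated [A] and write [A^E] for the sum of the translates
    [s^-1 A], [s] in [E].  Both sides are the infimum [mean_length A] of
    [L(A^E) / |E|], and neither comparison cuts the finite model into tiles: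
    everything rests on covering inequalities.

    For a finite family of submodules the length of the partial joins is a
    submodular function, so it has a base (join_weights): nonnegative weights of
    full total mass whose sum over any subfamily is at most the length of its
    join.  If every index is covered [n] times by subfamilies whose joins have
    small length, summing the weights bounds [n] times the length of the whole.
    Covering a Folner set by right translates of a fixed [E] shows that the limit
    defining the mean length is the infimum (mL_subE).

    Upper bound (sofic_mod_upper).  Cover the [d] points by the sets [E v], using
    the permutations [sigma s].  Modulo the relations with coefficients in
    [A^E], the copies of [A] over [E v] all lie in the copy of [A^E] at [v], so
    the sofic length is at most [d L(A^E) / |E|] up to the few points where
    [sigma] is not injective on [E].

    Lower bound (mean_le_sofic_mod).  Let [B] contain [A] and the coefficients
    of the relations, and let [Z] be the submodule of [B^d] generated by the
    local relations: for each [v], the combinations over [E v] of elements of [B]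
    that already vanish in the module, [E] being a large fixed set.  Relations with
    coefficients in [B] whose sum lies in [B^d] are in [Z] (sofic_rel_local), so
    the sofic length is at least [L(A^d + Z) - L(Z)].  Two covering inequalities
    finish the proof.
    - [L(Z)] is at most about [d (L(B) - mean_length B)]: over a Folner set [S]
      the relations at the points of [S v] are relations between the translates
      of [B] by [E S], and these have length [|E S| L(B) - L(B^(E S))]
      (len_join_local_rel, len_cycles).
    - [L(B^d) - L(A^d + Z)] is at most about
      [d (mean_length B - mean_length A)]: modulo [A^d + Z] the copies of [B] over
      [P v] span a quotient of [B^P / A^P], where [P] nearly realises the infimum
      for [B] (len_translates_quotient, len_pow_quotient).

    Points where [sigma] fails to be an action, or to be free, on a given finite
    set have density tending to zero (bad_negligible), and sofic lengths are
    bounded, so they converge along the ultrafilter and the bounds pass to the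
    limit.  The statement on submodules follows because the amenable mean
    length of [A] only sees translates of [A], which do not depend on the ambient
    module. *)

(** * Submodules *)

Section Lattice.
Variables (R : pzRingType) (U : lmodType R).
Implicit Types (N T : submodClosed U) (P : set U).

Definition subsm N T : Prop := forall x, x \in N -> x \in T.

Lemma asbool_submod_closed P :
  P 0 -> (forall x y, P x -> P y -> P (x + y)) ->
  (forall a x, P x -> P (a *: x)) ->
  subsemimod_closed (fun x => `[< P x >]).
Proof.
move=> P0 PD PZ; split; first split; first exact/asboolP.
  by move=> x y /asboolP Px /asboolP Py; apply/asboolP/PD.
by move=> a x /asboolP Px; apply/asboolP/PZ.
Qed.

Definition submod_of P (P0 : P 0) (PD : forall x y, P x -> P y -> P (x + y))
    (PZ : forall a x, P x -> P (a *: x)) : submodClosed U :=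
  HB.pack_for (submodClosed U) (fun x : U => `[< P x >])
    (GRing.isSubmodClosed.Build R U (fun x => `[< P x >])
       (asbool_submod_closed P0 PD PZ)).

Lemma in_submod_of P (P0 : P 0) (PD : forall x y, P x -> P y -> P (x + y))
    (PZ : forall a x, P x -> P (a *: x)) x : x \in submod_of P0 PD PZ <-> P x.
Proof. by split=> [/asboolP|Px] //; apply/asboolP. Qed.

Lemma mem_gen_submod (S : set U) x : S x -> x \in gen_submod S.
Proof. by move=> Sx; apply/asboolP=> N; apply. Qed.

Lemma gen_submod_sub (S : set U) N :
  (forall x, S x -> x \in N) -> subsm (gen_submod S) N.
Proof. by move=> SN x /asboolP; apply. Qed.

Definition addsm_pred N T : set U :=
  fun x => exists y z, [/\ y \in N, z \in T & x = y + z].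

Lemma addsm0 N T : addsm_pred N T 0.
Proof. by exists 0, 0; rewrite !rpred0 addr0. Qed.

Lemma addsmD N T x y :
  addsm_pred N T x -> addsm_pred N T y -> addsm_pred N T (x + y).
Proof.
move=> [x1 [x2 [Nx Tx ->]]] [y1 [y2 [Ny Ty ->]]].
by exists (x1 + y1), (x2 + y2); rewrite !rpredD // addrACA.
Qed.

Lemma addsmZ N T a x : addsm_pred N T x -> addsm_pred N T (a *: x).
Proof.
move=> [x1 [x2 [Nx Tx ->]]].
by exists (a *: x1), (a *: x2); rewrite !rpredZ // scalerDr.
Qed.

Definition addsm N T := submod_of (addsm0 N T) (@addsmD N T) (@addsmZ N T).

Lemma addsmP N T x :
  x \in addsm N T <-> exists y z, [/\ y \in N, z \in T & x = y + z].
Proof. exact: in_submod_of. Qed.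

Definition capsm_pred N T : set U := fun x => x \in N /\ x \in T.

Lemma capsm0 N T : capsm_pred N T 0.
Proof. by split; apply: rpred0. Qed.

Lemma capsmD N T x y :
  capsm_pred N T x -> capsm_pred N T y -> capsm_pred N T (x + y).
Proof. by move=> [? ?] [? ?]; split; apply: rpredD. Qed.

Lemma capsmZ N T a x : capsm_pred N T x -> capsm_pred N T (a *: x).
Proof. by move=> [? ?]; split; apply: rpredZ. Qed.

Definition capsm N T := submod_of (capsm0 N T) (@capsmD N T) (@capsmZ N T).

Lemma capsmP N T x : x \in capsm N T <-> x \in N /\ x \in T.
Proof. exact: in_submod_of. Qed.

Lemma addsm_subl N T : subsm N (addsm N T).
Proof. by move=> x Nx; apply/addsmP; exists x, 0; rewrite rpred0 addr0. Qed.

Lemma addsm_subr N T : subsm T (addsm N T).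
Proof. by move=> x Tx; apply/addsmP; exists 0, x; rewrite rpred0 add0r. Qed.

Lemma addsm_sub N T S :
  subsm N S -> subsm T S -> subsm (addsm N T) S.
Proof.
move=> NS TS x /addsmP[y [z [Ny Tz ->]]].
by rewrite rpredD //; [apply: NS | apply: TS].
Qed.

Definition join (I : choiceType) (T : I -> submodClosed U) (S : {fset I}) :=
  gen_submod [set x | exists2 i, i \in S & x \in T i]%classic.

Section Join.
Variables (I : choiceType) (T : I -> submodClosed U).

Lemma join_sup i (S : {fset I}) : i \in S -> subsm (T i) (join T S).
Proof. by move=> iS x Tx; apply: mem_gen_submod; exists i. Qed.

Lemma join_sub (S : {fset I}) N :
  (forall i, i \in S -> subsm (T i) N) -> subsm (join T S) N.
Proof. by move=> TN; apply: gen_submod_sub => x [i iS]; apply: TN. Qed.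

Lemma join_mono (S S' : {fset I}) :
  (S `<=` S')%fset -> subsm (join T S) (join T S').
Proof.
by move=> SS'; apply: join_sub => i iS; apply/join_sup/(fsubsetP SS').
Qed.

Lemma join0 x : x \in join T fset0 -> x = 0.
Proof.
have Z0 : [set y : U | y = 0]%classic 0 by [].
have ZD (y z : U) : y = 0 -> z = 0 -> y + z = 0 by move=> -> ->; rewrite addr0.
have ZZ a (y : U) : y = 0 -> a *: y = 0 by move=> ->; rewrite scaler0.
by move/(@join_sub fset0 (submod_of Z0 ZD ZZ))/in_submod_of; apply.
Qed.

Lemma join1U_sub i (S : {fset I}) :
  subsm (join T (i |` S)%fset) (addsm (T i) (join T S)).
Proof.
apply: join_sub => j; rewrite in_fset1U => /orP[/eqP ->|jS] x Tx.
  exact: addsm_subl.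
exact/addsm_subr/(join_sup jS).
Qed.

End Join.

End Lattice.

Lemma image_submodP (R : pzRingType) (U V : lmodType R) (f : {linear U -> V})
    (N : submodClosed U) y :
  reflect (exists2 x, x \in N & f x = y) (y \in image_submod f N).
Proof. exact: asboolP. Qed.

Lemma mem_image_submod (R : pzRingType) (U V : lmodType R)
    (f : {linear U -> V}) (N : submodClosed U) x :
  x \in N -> f x \in image_submod f N.
Proof. by move=> Nx; apply/image_submodP; exists x. Qed.

Lemma gen_submod_map (R : pzRingType) (U V : lmodType R) (f : {linear U -> V})
    (S : set U) (P : submodClosed V) :
  (forall x, S x -> f x \in P) -> forall x, x \in gen_submod S -> f x \in P.
Proof.
move=> SP x xS.
have f0 : [set y | f y \in P]%classic 0 by rewrite /= linear0 rpred0.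
have fD y z : f y \in P -> f z \in P -> f (y + z) \in P.
  by move=> ? ?; rewrite linearD rpredD.
have fZ a y : f y \in P -> f (a *: y) \in P by move=> ?; rewrite linearZ rpredZ.
suff sub : subsm (gen_submod S) (submod_of f0 fD fZ) by have /in_submod_of := sub x xS.
by apply: gen_submod_sub => y Sy; apply/in_submod_of/SP.
Qed.

Lemma quot_proj_eq0 (R : pzRingType) (U : lmodType R) (N : submodClosed U) x :
  quot_proj N x = 0 <-> x \in N.
Proof.
rewrite -(raddf0 (quot_proj N)); split => [/quot_projP|xN]; first by rewrite subr0.
by apply/quot_projP; rewrite subr0.
Qed.

(** * Length calculus *)

Section SubmodMap.
Variables (R : pzRingType) (U V : lmodType R) (f : {linear U -> V}).
Variables (N : submodClosed U) (P : submodClosed V).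
Hypothesis fNP : forall x, x \in N -> f x \in P.

Definition submod_map (x : submod N) : submod P :=
  exist _ (f (\val x)) (fNP (valP x)).

Lemma submod_map_linear : linear submod_map.
Proof. by move=> a x y; apply: val_inj; rewrite /= linearP. Qed.

HB.instance Definition _ := GRing.isLinear.Build R (submod N) (submod P)
  *:%R submod_map submod_map_linear.

End SubmodMap.

Section Length.
Variables (K : realType) (R : pzRingType) (L : lmodType R -> \bar K).
Hypothesis hL : length_function L.

(** Additivity on exact sequences, transported from module structures to
    submodules given by predicates. *)
Lemma length_kernel (U V : lmodType R) (f : {linear U -> V})
    (N N' : submodClosed U) (P : submodClosed V) :
  (forall x, x \in N -> f x \in P) ->
  (forall y, y \in P -> exists2 x, x \in N & f x = y) ->
  (forall x, x \in N' <-> x \in N /\ f x = 0) ->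
  L (submod N) = (L (submod N') + L (submod P))%E.
Proof.
move=> fNP fsurj kerf.
have idN x : x \in N' -> (idfun : {linear U -> U}) x \in N.
  by move=> /kerf[].
apply: (length_exact hL (f := submod_map idN) (g := submod_map fNP)).
- by move=> x y /(congr1 val) /= /val_inj.
- move=> y; split => [/(congr1 val) /= fy0|[x <-]].
    have N'y : \val y \in N' by apply/kerf; split; first exact: valP.
    by exists (exist _ (\val y) N'y); apply: val_inj.
  apply: val_inj => /=.
  by have /kerf[] := valP x.
- move=> z; have [x Nx fx] := fsurj _ (valP z).
  by exists (exist _ x Nx); apply: val_inj.
Qed.

(** Lengths are compared as real numbers; [len] is meaningful only together with
    [finl]. *)
Definition finl (U : lmodType R) (N : submodClosed U) := (L (submod N) < +oo)%E.
Definition len (U : lmodType R) (N : submodClosed U) : K := fine (L (submod N)).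

Lemma finlE (U : lmodType R) (N : submodClosed U) :
  finl N -> L (submod N) = (len N)%:E.
Proof.
by move=> finN; rewrite fineK // ge0_fin_numE ?(length_ge0 hL).
Qed.


Lemma length_iso (U V : lmodType R) (f : {linear U -> V})
    (N : submodClosed U) (P : submodClosed V) :
  (forall x, x \in N -> f x \in P) ->
  (forall y, y \in P -> exists2 x, x \in N & f x = y) ->
  (forall x, x \in N -> f x = 0 -> x = 0) ->
  L (submod N) = L (submod P).
Proof.
move=> fNP fsurj finj; pose O := join (fun i : 'I_0 => N) fset0.
have O0 x : x \in O -> x = 0 by apply: join0.
rewrite (length_kernel (N' := O) fNP fsurj) => [|x].
  rewrite (length_zero hL (M := submod O)) ?add0e // => x.
  by apply: val_inj; apply/O0/valP.
split=> [/O0 ->|[Nx fx]]; first by rewrite rpred0 linear0.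
by rewrite (finj x Nx fx) rpred0.
Qed.

Lemma length_ext (U : lmodType R) (N N' : submodClosed U) :
  N =i N' -> L (submod N) = L (submod N').
Proof.
move=> eqN; apply: (length_iso (f := idfun : {linear U -> U})) => x //=.
- by rewrite eqN.
- by move=> N'x; exists x; rewrite ?eqN.
Qed.

Lemma length_image (U V : lmodType R) (f : {linear U -> V})
    (N N' : submodClosed U) :
  (forall x, x \in N' <-> x \in N /\ f x = 0) ->
  L (submod N) = (L (submod N') + L (submod (image_submod f N)))%E.
Proof.
move=> kerf; apply: (length_kernel (f := f)) => // [x|y].
  exact: mem_image_submod.
by move/image_submodP.
Qed.

Lemma length_proj (U : lmodType R) (N T : submodClosed U) :
  L (submod N) =
  (L (submod (capsm N T)) + L (submod (image_submod (quot_proj T) N)))%E.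
Proof.
apply: length_image => x.
split => [/capsmP[-> Tx]|[Nx /quot_proj_eq0 Tx]]; last exact/capsmP.
by split=> //; apply/quot_proj_eq0.
Qed.

Lemma length_le (U : lmodType R) (N N' : submodClosed U) :
  subsm N N' -> (L (submod N) <= L (submod N'))%E.
Proof.
move=> NN'; rewrite (length_proj N' N).
rewrite (length_ext (N := capsm N' N) (N' := N)) => [|x]; first by rewrite leeDl ?(length_ge0 hL).
by apply/idP/idP => [/capsmP[]//|Nx]; apply/capsmP; split=> //; apply: NN'.
Qed.

Lemma length_image_le (U V : lmodType R) (f : {linear U -> V})
    (N : submodClosed U) (P : submodClosed V) :
  (forall y, y \in P -> exists2 x, x \in N & f x = y) ->
  (L (submod P) <= L (submod N))%E.
Proof.
move=> fsurj; apply: (@le_trans _ _ (L (submod (image_submod f N)))).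
  by apply: length_le => y /fsurj /image_submodP.
have k0 : [set x | x \in N /\ f x = 0]%classic 0.
  by split; [apply: rpred0 | apply: linear0].
have kD x y : x \in N /\ f x = 0 -> y \in N /\ f y = 0 ->
    x + y \in N /\ f (x + y) = 0.
  by move=> [? fx] [? fy]; rewrite rpredD // linearD fx fy addr0.
have kZ a x : x \in N /\ f x = 0 -> a *: x \in N /\ f (a *: x) = 0.
  by move=> [? fx]; rewrite rpredZ // linearZ /= fx scaler0.
rewrite (length_image (f := f) (N' := submod_of k0 kD kZ)) => [|x].
  by rewrite leeDr ?(length_ge0 hL).
exact: in_submod_of.
Qed.

(** Projecting modulo [T] identifies the images of [N + T] and of [N]. *)
Lemma length_modular (U : lmodType R) (N T : submodClosed U) :
  (L (submod (addsm N T)) + L (submod (capsm N T)) =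
   L (submod N) + L (submod T))%E.
Proof.
rewrite (length_proj (addsm N T) T) (length_proj N T).
rewrite (length_ext (N := capsm _ T) (N' := T)) => [|x].
  rewrite (length_ext (N := image_submod _ (addsm N T))
                      (N' := image_submod (quot_proj T) N)) => [|y].
    by rewrite addeC [X in (_ + X)%E]addeC addeA.
  apply/image_submodP/image_submodP => [[x]|[x Nx <-]].
    move=> /addsmP[y1 [y2 [Ny Ty ->]]] <-; exists y1 => //.
    by rewrite raddfD /=; have /quot_proj_eq0 -> := Ty; rewrite addr0.
  by exists x => //; apply: addsm_subl.
by apply/idP/idP => [/capsmP[]//|Tx]; apply/capsmP; split=> //; apply: addsm_subr.
Qed.

Lemma finl_le (U : lmodType R) (N N' : submodClosed U) :
  subsm N N' -> finl N' -> finl N.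
Proof. by move=> /length_le; apply: le_lt_trans. Qed.

Lemma len_le (U : lmodType R) (N N' : submodClosed U) :
  subsm N N' -> finl N' -> len N <= len N'.
Proof.
move=> NN' finN'; have finN := finl_le NN' finN'.
by rewrite -lee_fin -!finlE // length_le.
Qed.

Lemma len_ge0 (U : lmodType R) (N : submodClosed U) : 0 <= len N.
Proof. by rewrite fine_ge0 ?(length_ge0 hL). Qed.

Lemma finl_add (U : lmodType R) (N T : submodClosed U) :
  finl N -> finl T -> finl (addsm N T).
Proof.
move=> finN finT; apply: (@le_lt_trans _ _ (L (submod N) + L (submod T))%E).
  by rewrite -length_modular leeDl ?(length_ge0 hL).
by rewrite lte_add_pinfty.
Qed.

Lemma len_modular (U : lmodType R) (N T : submodClosed U) :
  finl N -> finl T -> len (addsm N T) + len (capsm N T) = len N + len T.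
Proof.
move=> finN finT; have finC : finl (capsm N T).
  by apply: finl_le finN => x /capsmP[].
apply: EFin_inj; rewrite !EFinD -!finlE //; last exact: finl_add.
exact: length_modular.
Qed.

Lemma len_proj (U : lmodType R) (N T : submodClosed U) : finl N ->
  len N = len (capsm N T) + len (image_submod (quot_proj T) N).
Proof.
move=> finN; have finC : finl (capsm N T).
  by apply: finl_le finN => x /capsmP[].
have finI : finl (image_submod (quot_proj T) N).
  apply: (@le_lt_trans _ _ (L (submod N))) => //.
  by apply: (length_image_le (f := quot_proj T)) => y /image_submodP.
apply: EFin_inj; rewrite !EFinD -!finlE //.
exact: length_proj.
Qed.

Lemma length_join0 (U : lmodType R) (I : choiceType) (T : I -> submodClosed U) :
  L (submod (join T fset0)) = 0%E.
Proof.
by apply: (length_zero hL) => x; have /join0 x0 := valP x; apply: val_inj.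
Qed.

Lemma finl_join (U : lmodType R) (I : choiceType) (T : I -> submodClosed U)
    (S : {fset I}) : (forall i, i \in S -> finl (T i)) -> finl (join T S).
Proof.
elim/finSet_rect: S => S IH finT.
have [->|[i iS]] := fset_0Vmem S; first by rewrite /finl length_join0 ltry.
rewrite -(fsetD1K iS); apply: (finl_le (@join1U_sub _ _ _ _ _ _)).
apply: finl_add; first exact: finT.
apply: IH; first exact: fproperD1.
by move=> j /fsetD1P[_ jS]; apply: finT.
Qed.

(** The base of a submodular function, built greedily: adjoin the members of [S]
    one at a time and let the weight of each be the increment of the length.  By
    the modular law the increment along a subfamily is at least as large, so the
    weights of a subfamily never exceed the length of its join. *)
Lemma join_weights (U : lmodType R) (I : choiceType) (T : I -> submodClosed U)
    (S : {fset I}) : (forall i, i \in S -> finl (T i)) ->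
  exists c : I -> K, [/\ (forall i, 0 <= c i),
    \sum_(i <- S) c i = len (join T S) &
    forall E : {fset I}, (E `<=` S)%fset ->
      \sum_(i <- E) c i <= len (join T E)].
Proof.
elim/finSet_rect: S => S IH finT.
have [->|[i iS]] := fset_0Vmem S.
  have len0 : len (join T fset0) = 0 by rewrite /len length_join0.
  exists (fun=> 0); split=> // [|E]; first by rewrite big_seq_fset0 len0.
  by rewrite fsubset0 => /eqP ->; rewrite big_seq_fset0 len0.
set S' := (S `\ i)%fset; have S'S : (S' `<=` S)%fset by apply: fsubD1set.
have iS' : i \notin S' by rewrite !inE eqxx.
have finT' j : j \in S' -> finl (T j) by move/(fsubsetP S'S)/finT.
have [c' [c'0 sumc' subc']] := IH _ (fproperD1 iS) finT'.
have finJ E : (E `<=` S)%fset -> finl (join T E).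
  by move=> ES; apply: finl_join => j /(fsubsetP ES)/finT.
pose c j := if j == i then len (join T S) - len (join T S') else c' j.
have sumE E : i \notin E -> \sum_(j <- E) c j = \sum_(j <- E) c' j.
  move=> iE; apply: eq_big_seq => j jE; rewrite /c; case: eqP => // ji.
  by rewrite -ji jE in iE.
exists c; split.
- move=> j; rewrite /c; case: ifP => // _; rewrite subr_ge0.
  by apply: len_le; [apply: join_mono | apply: finJ].
- rewrite -(fsetD1K iS) big_fsetU1 //= sumE // sumc' fsetD1K //.
  by rewrite /c eqxx subrK.
move=> E ES; have [iE|iE] := boolP (i \in E); last first.
  by rewrite sumE // subc' // fsubsetD1 ES.
set E' := (E `\ i)%fset; have E'E : (E' `<=` E)%fset by apply: fsubD1set.
have iE' : i \notin E' by rewrite !inE eqxx.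
rewrite -(fsetD1K iE) big_fsetU1 //= sumE // fsetD1K // {1}/c eqxx.
have E'S' : (E' `<=` S')%fset by apply: fsetSD.
have finE := finJ _ ES; have finS' := finJ _ S'S.
have := len_modular finE finS'.
have addE : len (addsm (join T E) (join T S')) = len (join T S).
  rewrite /len; congr fine; apply: length_ext => x; apply/idP/idP.
    by apply: addsm_sub; apply: join_mono.
  rewrite -(fsetD1K iS) => /join1U_sub; apply: addsm_sub => y Ty.
    exact/addsm_subl/(join_sup iE).
  exact: addsm_subr.
have finC : finl (capsm (join T E) (join T S')).
  by apply: finl_le finE => x /capsmP[].
have := len_le (N := join T E') (N' := capsm (join T E) (join T S')).
move=> /(_ _ finC) le1 eq1.
rewrite -lerBrDl; apply: le_trans (subc' _ E'S') _.
rewrite addE in eq1.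
have -> : len (join T E) - (len (join T S) - len (join T S')) =
   len (capsm (join T E) (join T S')).
  apply: (@addrI _ (len (join T S))); rewrite eq1 addrC opprB addrA.
  by rewrite addrNK.
apply: le1 => x E'x; apply/capsmP; split; exact: (join_mono _ E'x).
Qed.

End Length.

(** * Covering inequalities *)

(** The index type as a finite set, for families indexed by all of ['I_d]. *)
Definition fullset (d : nat) : {fset 'I_d} := [fset i | i : 'I_d]%fset.

Lemma in_fullset (d : nat) (i : 'I_d) : i \in fullset d.
Proof. by apply/imfsetP; exists i. Qed.

Lemma big_fullset (d : nat) (V : nmodType) (F : 'I_d -> V) :
  \sum_(i <- fullset d) F i = \sum_i F i.
Proof.
apply: perm_big; apply: uniq_perm; rewrite ?fset_uniq ?index_enum_uniq //.
by move=> i; rewrite mem_index_enum in_fullset.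
Qed.

Lemma sum_imfset (V : nmodType) (I J : choiceType) (h : I -> J) (A : {fset I})
    (c : J -> V) : {in A &, injective h} ->
  \sum_(j <- [fset h i | i in A]%fset) c j = \sum_(i <- A) c (h i).
Proof. by move=> injh; rewrite big_imfset. Qed.

Section Covering.
Variables (K : realType) (R : pzRingType) (L : lmodType R -> \bar K).
Hypothesis hL : length_function L.
Variables (Gamma : groupType) (U : lmodType R).

(** The sets [E v] cover every point exactly [|E|] times, each [sigma s] being a
    permutation, so the weights of join_weights add up to [|E|] times the whole.
    The weights over [E v] are bounded by [D] when its points are distinct, and
    trivially by [|E| C] otherwise. *)
Lemma len_join_perm_cover (d : nat) (T : 'I_d -> submodClosed U)
    (E : {fset Gamma}) (sigma : Gamma -> 'S_d) (good : pred 'I_d) (C D : K) :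
  (forall w, finl L (T w)) -> (forall w, len L (T w) <= C) -> 0 <= D ->
  (forall v, good v -> {in E &, injective (fun s => sigma s v)}) ->
  (forall v, good v -> len L (join T [fset sigma s v | s in E]%fset) <= D) ->
  #|` E|%:R * len L (join T (fullset d)) <=
    d%:R * D + #|` E|%:R * (#|[pred v | ~~ good v]|%:R * C).
Proof.
move=> finT lenT D0 injE lenE.
have [c [c0 sumc subc]] := join_weights hL (S := fullset d) (fun w _ => finT w).
have sub_full (S : {fset 'I_d}) : (S `<=` fullset d)%fset.
  by apply/fsubsetP => i _; apply: in_fullset.
have cC w : c w <= C.
  have := subc _ (sub_full [fset w]%fset); rewrite big_seq_fset1 => /le_trans.
  apply; apply: le_trans (lenT w); apply: len_le => //.
  by apply: join_sub => i; rewrite inE => /eqP ->.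
rewrite -sumc big_fullset.
have -> : #|` E|%:R * \sum_i c i = \sum_i \sum_(s <- E) c (sigma s i).
  rewrite [RHS]exchange_big /= [RHS](eq_bigr (fun=> \sum_i c i)) => [|s _].
    by rewrite big_const_seq count_predT iter_addr_0 mulr_natl.
  by rewrite [RHS](reindex_inj (@perm_inj _ (sigma s))).
rewrite (bigID good) /=; apply: lerD.
  apply: (@le_trans _ _ (\sum_(i | good i) D)).
    apply: ler_sum => v gv; apply: le_trans (lenE v gv).
    have := subc _ (sub_full [fset sigma s v | s in E]%fset).
    by rewrite (sum_imfset c (injE v gv)).
  rewrite sumr_const -[D *+ _]mulr_natl ler_wpM2r // ler_nat.
  by rewrite -[leqRHS]card_ord max_card.
apply: (@le_trans _ _ (\sum_(i | ~~ good i) #|` E|%:R * C)).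
  apply: ler_sum => v _; apply: (@le_trans _ _ (\sum_(s <- E) C)).
    by apply: ler_sum.
  by rewrite big_const_seq count_predT iter_addr_0 mulr_natl.
by rewrite sumr_const -[leLHS]mulr_natl mulrCA.
Qed.

(** The same count in the group: the right translates of [E] that meet [F] are
    those by elements of [E^-1 F], and they cover each point of [F] exactly [|E|]
    times. *)
Lemma len_join_translate_cover (T : Gamma -> submodClosed U)
    (E F : {fset Gamma}) (D : K) :
  (forall s, finl L (T s)) ->
  (forall s, len L (join T [fset (k * s)%g | k in E]%fset) <= D) ->
  #|` E|%:R * len L (join T F) <=
    #|` [fset (k * s)%g | k in [fset k^-1%g | k in E], s in F]%fset|%:R * D.
Proof.
move=> finT lenE; set G := (X in #|` X|%:R * D).
have [c [c0 sumc subc]] := join_weights hL (S := F) (fun w _ => finT w).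
rewrite -sumc.
have -> : #|` E|%:R * \sum_(i <- F) c i =
    \sum_(s <- G) \sum_(k <- E | (k * s)%g \in F) c (k * s)%g.
  rewrite [RHS](exchange_big_dep xpredT) //=.
  rewrite [RHS](eq_big_seq (fun=> \sum_(i <- F) c i)) => [|k kE].
    by rewrite big_const_seq count_predT iter_addr_0 mulr_natl.
  rewrite -big_filter.
  rewrite -(big_map (fun s => (k * s)%g) xpredT c).
  symmetry; apply: perm_big; apply: uniq_perm.
  - exact: fset_uniq.
  - by rewrite map_inj_uniq ?filter_uniq ?fset_uniq //; apply: mulgI.
  move=> t; apply/idP/idP => [tF|/mapP[s]]; last first.
    by rewrite mem_filter => /andP[ksF _] ->.
  apply/mapP; exists (k^-1 * t)%g; last by rewrite mulVKg.
  rewrite mem_filter mulVKg tF /=; apply/imfset2P; exists k^-1%g => /=.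
    by apply/imfsetP; exists k.
  by exists t.
apply: (@le_trans _ _ (\sum_(s <- G) D)); last first.
  by rewrite big_const_seq count_predT iter_addr_0 mulr_natl.
apply: ler_sum => s _; apply: le_trans (lenE s).
have finE S : finl L (join T S) by apply: finl_join.
rewrite -big_filter -(big_map (fun k => (k * s)%g) xpredT c).
pose S := [fset t in [seq (k * s)%g | k <- E & (k * s)%g \in F]]%fset.
have -> : \sum_(t <- [seq (k * s)%g | k <- E & (k * s)%g \in F]) c t =
    \sum_(t <- S) c t.
  apply: perm_big; apply: uniq_perm.
  - by rewrite map_inj_uniq ?filter_uniq ?fset_uniq //; apply: mulIg.
  - exact: fset_uniq.
  by move=> t; rewrite !inE.
apply: le_trans (subc S _) _.
  apply/fsubsetP => t; rewrite !inE => /mapP[k].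
  by rewrite mem_filter => /andP[ksF _] ->.
apply: len_le => //; apply: join_mono; apply/fsubsetP => t.
rewrite !inE => /mapP[k]; rewrite mem_filter => /andP[_ kE] ->.
by apply/imfsetP; exists k.
Qed.

End Covering.

(** * Finitely supported functions *)

Section Powers.
Variables (R : pzRingType) (I : choiceType) (V : lmodType R).

Definition ev (i : I) (f : I -> V) : V := f i.

Lemma ev_linear i : linear (ev i).
Proof. by []. Qed.

HB.instance Definition _ i := GRing.isLinear.Build R (I -> V) V *:%R (ev i)
  (ev_linear i).

Variables (B : submodClosed V) (E : {fset I}).

(** A finite direct power of [B], realised by functions on the whole index set so
    that enlarging [E] is an inclusion. *)
Definition supp_pred : set (I -> V) :=
  fun f => forall i, f i \in B /\ (i \notin E -> f i = 0).

Lemma supp0 : supp_pred 0.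
Proof. by move=> i; split=> //; apply: rpred0. Qed.

Lemma suppD f g : supp_pred f -> supp_pred g -> supp_pred (f + g).
Proof.
move=> Bf Bg i; have [[? f0] [? g0]] := (Bf i, Bg i).
by split=> [|iE]; [apply: rpredD | rewrite fctE f0 ?g0 ?addr0].
Qed.

Lemma suppZ a f : supp_pred f -> supp_pred (a *: f).
Proof.
move=> Bf i; have [? f0] := Bf i.
by split=> [|iE]; [apply: rpredZ | rewrite fctE f0 ?scaler0].
Qed.

Definition supp_submod := submod_of supp0 suppD suppZ.

Lemma supp_submodP f : f \in supp_submod <->
  forall i, f i \in B /\ (i \notin E -> f i = 0).
Proof. exact: in_submod_of. Qed.

End Powers.

Section PowerLength.
Variables (K : realType) (R : pzRingType) (L : lmodType R -> \bar K).
Hypothesis hL : length_function L.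

Lemma length_supp (I : choiceType) (V : lmodType R) (B : submodClosed V)
    (E : {fset I}) :
  finl L B -> L (submod (supp_submod B E)) = (#|` E|%:R * len L B)%:E.
Proof.
move=> finB; elim/finSet_rect: E => E IH.
have [->|[i iE]] := fset_0Vmem E.
  rewrite cardfs0 mul0r; apply: (length_zero hL) => f; apply: val_inj => /=.
  have /supp_submodP f0 := valP f; apply/funext => i; apply: (f0 i).2.
  by rewrite inE.
set E' := (E `\ i)%fset.
have iE' : i \notin E' by rewrite !inE eqxx.
rewrite (length_kernel hL (f := ev i) (N' := supp_submod B E') (P := B)).
- rewrite IH ?fproperD1 // finlE // -EFinD; congr EFin.
  by rewrite -[in RHS](fsetD1K iE) cardfsU1 iE' natrD mulrDl mul1r addrC.
- by move=> f /supp_submodP/(_ i)[].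
- move=> b Bb; exists (fun j => if j == i then b else 0); last by rewrite /= /ev eqxx.
  apply/supp_submodP => j; case: eqP => [->|_]; first by rewrite iE.
  by rewrite rpred0.
- move=> f; split=> [/supp_submodP Bf|[/supp_submodP Bf fi]].
    split; last by have [_ /(_ iE')] := Bf i.
    apply/supp_submodP => j; have [Bfj fj0] := Bf j; split=> // jE; apply: fj0.
    by rewrite !inE negb_and jE orbT.
  apply/supp_submodP => j; have [Bfj fj0] := Bf j; split=> //.
  by rewrite !inE negb_and negbK => /orP[/eqP ->|/fj0] //; exact: fi.
Qed.

Lemma finl_supp (I : choiceType) (V : lmodType R) (B : submodClosed V)
    (E : {fset I}) : finl L B -> finl L (supp_submod B E).
Proof. by move=> finB; rewrite /finl length_supp // ltry. Qed.

Lemma len_supp (I : choiceType) (V : lmodType R) (B : submodClosed V)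
    (E : {fset I}) : finl L B -> len L (supp_submod B E) = #|` E|%:R * len L B.
Proof. by move=> finB; rewrite /len length_supp. Qed.

End PowerLength.

Section FfunFun.
Variables (R : pzRingType) (I : finType) (V : lmodType R).

Definition fun_ffun (f : I -> V) : {ffun I -> V} := [ffun i => f i].

Lemma fun_ffun_linear : linear fun_ffun.
Proof. by move=> a f g; apply/ffunP => i; rewrite !ffunE. Qed.

HB.instance Definition _ := GRing.isLinear.Build R (I -> V) {ffun I -> V} *:%R
  fun_ffun fun_ffun_linear.

End FfunFun.

Section PowLength.
Variables (K : realType) (R : pzRingType) (L : lmodType R -> \bar K).
Hypothesis hL : length_function L.
Variables (V : lmodType R) (B : submodClosed V) (d : nat).
Hypothesis finB : finl L B.

Lemma pow_submodP (f : {ffun 'I_d -> V}) :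
  reflect (forall v, f v \in B) (f \in pow_submod B d).
Proof. exact: forallP. Qed.

Lemma length_pow : L (submod (pow_submod B d)) = (d%:R * len L B)%:E.
Proof.
transitivity (L (submod (supp_submod B (fullset d)))); last first.
  by rewrite length_supp // card_imfset //= size_enum_ord.
symmetry; apply: (length_iso hL (f := @fun_ffun R 'I_d V)) => [f|f|f].
- by move=> /supp_submodP Bf; apply/pow_submodP => v; rewrite ffunE; case: (Bf v).
- move=> /pow_submodP Bf; exists (fun v : 'I_d => f v); last by apply/ffunP => i; rewrite ffunE.
  by apply/supp_submodP => i; split=> //; rewrite in_fullset.
- by move=> _ /ffunP f0; apply/funext => i; have := f0 i; rewrite !ffunE.
Qed.

Lemma finl_pow : finl L (pow_submod B d).
Proof. by rewrite /finl length_pow ltry. Qed.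

Lemma len_pow : len L (pow_submod B d) = d%:R * len L B.
Proof. by rewrite /len length_pow. Qed.

End PowLength.

(** * Translates and the mean length along an amenable group *)

Section GroupAction.
Variables (R : pzRingType) (Gamma : groupType).
Variable M : lmodType (group_ring R Gamma).
Implicit Types (A B : submodClosed (restr M)) (F : {fset Gamma}).

Lemma gact1 (x : restr M) : gact 1%g x = x.
Proof. exact: scale1r. Qed.

Lemma gactM s t (x : restr M) : gact (s * t)%g x = gact s (gact t x).
Proof. by rewrite /gact scalerA GroupRing.monomM mulr1. Qed.

Lemma gactK s : cancel (@gact R Gamma M s) (gact s^-1%g).
Proof. by move=> x; rewrite -gactM mulVg gact1. Qed.

Lemma gactVK s : cancel (@gact R Gamma M s^-1%g) (gact s).
Proof. by move=> x; rewrite -gactM mulgV gact1. Qed.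

Lemma gact_linear s : linear (@gact R Gamma M s).
Proof.
move=> a x y; rewrite /gact scalerDr; congr (_ + _).
have scaleE (b : R) (z : restr M) : b *: z = GroupRing.monom 1%g b *: (z : M).
  by [].
rewrite !scaleE !scalerA !GroupRing.monomM.
by rewrite mulg1 mul1g mulr1 mul1r.
Qed.

HB.instance Definition _ s := GRing.isLinear.Build R (restr M) (restr M) *:%R
  (@gact R Gamma M s) (gact_linear s).

Definition translate A (s : Gamma) : submodClosed (restr M) :=
  image_submod (@gact R Gamma M s^-1%g) A.

Lemma translateP A s x :
  reflect (exists2 a, a \in A & gact s^-1%g a = x) (x \in translate A s).
Proof. exact: image_submodP. Qed.

Lemma in_translates A F s a :
  s \in F -> a \in A -> gact s^-1%g a \in translates A F.
Proof. by move=> sF aA; apply: mem_gen_submod; exists s, a. Qed.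

Lemma translates_join A F : translates A F =i join (translate A) F.
Proof.
move=> x; apply/idP/idP.
  apply: gen_submod_sub => y [s [a [sF aA ->]]].
  by apply: (join_sup sF); apply/translateP; exists a.
apply: join_sub => s sF y /translateP[a aA <-].
exact: in_translates.
Qed.

Lemma translates_mono A B F : subsm A B -> subsm (translates A F) (translates B F).
Proof.
move=> AB; apply: gen_submod_sub => y [s [a [sF aA ->]]].
by apply: in_translates => //; apply: AB.
Qed.

Lemma translates_gact A F F' t :
  (forall s, s \in F -> (s * t^-1)%g \in F') ->
  forall x, x \in translates A F -> gact t x \in translates A F'.
Proof.
move=> FF'; apply: (gen_submod_map (f := @gact R Gamma M t)).
move=> _ [s [a [sF aA ->]]] /=; rewrite -gactM.
have -> : (t * s^-1 = (s * t^-1)^-1)%g by rewrite invgF.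
by apply: in_translates => //; apply: FF'.
Qed.

End GroupAction.

Lemma card_translates_le (Gamma : groupType) (E F : {fset Gamma}) :
  (#|` [fset (s * t)%g | s in E, t in F]%fset| <=
   #|` F| + #|` [fset (s * t)%g | s in E, t in F] `\` F|%fset)%N.
Proof.
rewrite -(cardfsID F [fset (s * t)%g | s in E, t in F]%fset) leq_add2r.
exact/fsubset_leq_card/fsubsetIr.
Qed.

Section MeanLength.
Variables (K : realType) (R : pzRingType) (L : lmodType R -> \bar K).
Hypothesis hL : length_function L.
Variables (Gamma : groupType) (M : lmodType (group_ring R Gamma)).
Implicit Types (A B : submodClosed (restr M)) (F : {fset Gamma}).

Lemma length_translate A s : L (submod (translate A s)) = L (submod A).
Proof.
symmetry; apply: (length_iso hL (f := @gact R Gamma M s^-1%g)) => [x Ax|x|x _ /=].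
- by apply/translateP; exists x.
- by move/translateP.
- by move=> /(congr1 (gact s)); rewrite gactVK => ->; apply: linear0.
Qed.

Lemma finl_translate A s : finl L A -> finl L (translate A s).
Proof. by rewrite /finl length_translate. Qed.

Lemma finl_translates A F : finl L A -> finl L (translates A F).
Proof.
move=> finA; rewrite /finl (length_ext hL (@translates_join _ _ _ A F)).
by apply: finl_join => // s _; apply: finl_translate.
Qed.

Lemma len_translates_join A F :
  len L (translates A F) = len L (join (translate A) F).
Proof. by rewrite /len (length_ext hL (@translates_join _ _ _ A F)). Qed.

Lemma length_translates_right A F t :
  L (submod (translates A [fset (s * t)%g | s in F]%fset)) =
  L (submod (translates A F)).
Proof.
have FtF s : s \in [fset (s * t)%g | s in F]%fset -> (s * t^-1)%g \in F.
  by move=> /imfsetP[k /= kF ->]; rewrite mulgK.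
have FFt s : s \in F -> (s * t^-1^-1)%g \in [fset (s * t)%g | s in F]%fset.
  by move=> sF; apply/imfsetP; exists s; rewrite ?invgK.
apply: (length_iso hL (f := @gact R Gamma M t)) => [x|y Fy|x _ /=].
- exact: translates_gact.
- by exists (gact t^-1%g y); [apply: translates_gact Fy | apply: gactVK].
- by move=> /(congr1 (gact t^-1%g)); rewrite gactK => ->; apply: linear0.
Qed.

(** The mean length is defined as a limit; the infimum is the form that the
    estimates use, and [mL_subE] identifies the two. *)
Definition mean_length A : K :=
  inf [set len L (translates A F) / #|` F|%:R | F in [set F | F != fset0]]%classic.

Section Bounds.
Variable A : submodClosed (restr M).

Let has_inf_mean :
  has_inf [set len L (translates A F) / #|` F|%:R | F in [set F | F != fset0]]%classic.
Proof.
split.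
  exists (len L (translates A [fset 1%g]%fset) / #|` [fset (1%g : Gamma)]%fset|%:R).
  exists [fset 1%g]%fset => //=; apply/eqP => /fsetP/(_ 1%g).
  by rewrite !inE eqxx.
by exists 0 => _ [F _ <-]; rewrite divr_ge0 ?len_ge0 ?ler0n.
Qed.

Lemma mean_length_ge0 : 0 <= mean_length A.
Proof.
apply: lb_le_inf; first by case: has_inf_mean.
by move=> _ [F _ <-]; rewrite divr_ge0 ?len_ge0 ?ler0n.
Qed.

Lemma mean_length_le F :
  F != fset0 -> #|` F|%:R * mean_length A <= len L (translates A F).
Proof.
move=> F0; rewrite mulrC -ler_pdivlMr; last by rewrite ltr0n cardfs_gt0.
by apply: ge_inf; [case: has_inf_mean | exists F].
Qed.

Lemma mean_length_approx e : 0 < e ->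
  exists2 F, F != fset0 & len L (translates A F) <= #|` F|%:R * (mean_length A + e).
Proof.
move=> e0; have [_ [F F0 <-] ltF] := inf_adherent e0 has_inf_mean.
exists F => //; rewrite mulrC -ler_pdivrMr; last by rewrite ltr0n cardfs_gt0.
exact: ltW.
Qed.

End Bounds.

Hypothesis hGamma : amenable K Gamma.

#[local] Instance invariance_filter_proper : ProperFilter (invariance_filter K Gamma).
Proof.
apply: filter_from_proper.
  apply: filter_from_filter.
    exists ([fset 1%g]%fset, 1) => /=; split=> //.
    by apply/eqP => /fsetP/(_ 1%g); rewrite !inE eqxx.
  move=> [E1 d1] [E2 d2] /= [E10 d10] [E20 d20].
  exists ((E1 `|` E2)%fset, Num.min d1 d2) => /=.
    split; last by rewrite lt_min d10 d20.
    have [x xE] := fset0Pn _ E10.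
    by apply/fset0Pn; exists x; rewrite inE xE.
  move=> F /= [F0 invF].
  have sub E d : (E `<=` E1 `|` E2)%fset -> Num.min d1 d2 <= d ->
      left_invariant E d F.
    move=> EE dd; apply: le_lt_trans (lt_le_trans invF _).
      rewrite ler_nat; apply/fsubset_leq_card/fsetSD/fsubsetP => x.
      move=> /imfset2P[s /= sE [t /= tF ->]].
      apply/imfset2P; exists s => /=; first exact: (fsubsetP EE).
      by exists t.
    by rewrite ler_wpM2r.
  by split; split=> //; apply: sub; rewrite ?fsubsetUl ?fsubsetUr ?ge_min ?lexx ?orbT.
move=> [E e] /= [E0 e0]; have [F F0 invF] := hGamma E0 e0.
by exists F.
Qed.

(** Covering [F] by the right translates of a fixed [E] bounds the average
    over [F] by that over [E], up to the ratio of [E^-1 F] to [F]; hence the limit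
    is the infimum. *)
Lemma mL_subE A : finl L A -> mL_sub L A = (mean_length A)%:E.
Proof.
move=> finA; rewrite /mL_sub; apply: cvg_lim; first exact: ereal_hausdorff.
have LE F : (L (submod (translates A F)) * (#|` F|%:R^-1)%:E)%E =
    (len L (translates A F) / #|` F|%:R)%:E.
  by rewrite finlE ?EFinM //; apply: finl_translates.
under eq_fun do rewrite LE.
apply: cvg_EFin; first by apply: nearW.
apply/cvgrPdist_lt => e e0 /=.
set m := mean_length A; have m0 : 0 <= m by apply: mean_length_ge0.
pose e2 := e / 2; have e20 : 0 < e2 by rewrite divr_gt0.
have [E E0 leE] := mean_length_approx A e20.
have me0 : 0 < m + e2 by rewrite ltr_wpDl.
pose E' := [fset k^-1%g | k in E]%fset.
have cE0 : 0 < (#|` E|%:R : K) by rewrite ltr0n cardfs_gt0.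
(* If [E^-1 F] has at most [(1 + delta) |F|] elements, the average over [F] is
   at most [(1 + delta) (m + e2)], which is [m + e] for this [delta]. *)
exists (E', e2 / (m + e2)) => /=.
  split; last exact: divr_gt0.
  have [x xE] := fset0Pn _ E0.
  by apply/fset0Pn; exists x^-1%g; apply/imfsetP; exists x.
move=> F [F0 invF]; have cF0 : 0 < (#|` F|%:R : K) by rewrite ltr0n cardfs_gt0.
have mF : m <= len L (translates A F) / #|` F|%:R.
  by rewrite ler_pdivlMr // mulrC mean_length_le.
rewrite distrC ger0_norm ?subr_ge0 // ltrBlDr ltr_pdivrMr //.
have cover : #|` E|%:R * len L (translates A F) <=
    #|` [fset (k * s)%g | k in E', s in F]%fset|%:R * len L (translates A E).
  rewrite len_translates_join; apply: len_join_translate_cover => // s.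
    exact: finl_translate.
  by rewrite -len_translates_join /len length_translates_right.
rewrite -(ltr_pM2l cE0); apply: le_lt_trans cover _.
apply: (@le_lt_trans _ _ (#|` [fset (k * s)%g | k in E', s in F]%fset|%:R *
    (#|` E|%:R * (m + e2)))); first by rewrite ler_wpM2l.
rewrite mulrCA ltr_pM2l //.
apply: (@le_lt_trans _ _ ((#|` F|%:R +
    #|` [fset (s * t)%g | s in E', t in F] `\` F|%fset%:R) * (m + e2))).
  by rewrite ler_pM2r // -natrD ler_nat card_translates_le.
rewrite mulrDl; apply: (@lt_le_trans _ _
   (#|` F|%:R * (m + e2) + e2 / (m + e2) * #|` F|%:R * (m + e2))).
  by rewrite ltrD2l ltr_pM2r.
rewrite (mulrAC _ _ (m + e2)) divfK ?gt_eqF // [e2 * _]mulrC -mulrDr -addrA.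
by rewrite -splitr mulrC addrC.
Qed.

End MeanLength.

(** * Finite permutation models *)

Section Kernel.
Variables (R : pzRingType) (U V : lmodType R) (f : {linear U -> V}).

Let ker_set : set U := fun x => f x = 0.

Let ker0 : ker_set 0. Proof. exact: linear0. Qed.

Let kerD x y : ker_set x -> ker_set y -> ker_set (x + y).
Proof. by rewrite /ker_set linearD => -> ->; rewrite addr0. Qed.

Let kerZ a x : ker_set x -> ker_set (a *: x).
Proof. by rewrite /ker_set linearZ /= => ->; rewrite scaler0. Qed.

Definition kersm : submodClosed U := submod_of ker0 kerD kerZ.

Lemma kersmP x : x \in kersm <-> f x = 0.
Proof. exact: in_submod_of. Qed.

End Kernel.

Section ImageLength.
Variables (K : realType) (R : pzRingType) (L : lmodType R -> \bar K).
Hypothesis hL : length_function L.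
Variables (U V : lmodType R) (f : {linear U -> V}).

Lemma finl_image (N : submodClosed U) : finl L N -> finl L (image_submod f N).
Proof.
move=> finN; apply: (@le_lt_trans _ _ (L (submod N))) => //.
by apply: (length_image_le hL (f := f)) => y /image_submodP.
Qed.

Lemma len_image_le (N : submodClosed U) :
  finl L N -> len L (image_submod f N) <= len L N.
Proof.
move=> finN; rewrite -lee_fin -!finlE //; last exact: finl_image.
by apply: (length_image_le hL (f := f)) => y /image_submodP.
Qed.

Lemma len_image_kernel (N N' : submodClosed U) :
  finl L N -> subsm N' N -> (forall x, x \in N' -> f x = 0) ->
  len L (image_submod f N) + len L N' <= len L N.
Proof.
move=> finN N'N fN'; have finC : finl L (capsm N (kersm f)).
  by apply: (finl_le hL) finN => x /capsmP[].
have -> : len L N = len L (capsm N (kersm f)) + len L (image_submod f N).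
  apply: EFin_inj; rewrite EFinD -!finlE //; last exact: finl_image.
  apply: (length_image hL) => x.
  split => [/capsmP[-> /kersmP ->] //|[Nx fx]].
  by apply/capsmP; split=> //; apply/kersmP.
rewrite addrC lerD2r; apply: len_le => // x N'x.
by apply/capsmP; split; [apply: N'N | apply/kersmP/fN'].
Qed.

End ImageLength.

Section Delta.
Variables (R : pzRingType) (Gamma : groupType).
Variable M : lmodType (group_ring R Gamma).
Variable d : nat.
Local Notation U := {ffun 'I_d -> restr M}.

Lemma delta_linear (v : 'I_d) : linear (@delta R Gamma M d v).
Proof.
move=> a x y; apply/ffunP => w; rewrite !ffunE.
by case: eqP => _ //; rewrite scaler0 addr0.
Qed.

HB.instance Definition _ (v : 'I_d) := GRing.isLinear.Build R (restr M) U *:%R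
  (@delta R Gamma M d v) (delta_linear v).

Lemma sum_delta (f : U) : f = \sum_v delta v (f v).
Proof.
apply/ffunP => w; rewrite sum_ffunE (bigD1 w) //= ffunE eqxx big1 ?addr0 //.
by move=> v vw; rewrite ffunE eq_sym (negPf vw).
Qed.

Definition delta_submod (B : submodClosed (restr M)) (v : 'I_d) : submodClosed U :=
  image_submod (@delta R Gamma M d v) B.

Lemma pow_submod_join (B : submodClosed (restr M)) :
  subsm (pow_submod B d) (join (delta_submod B) (fullset d)).
Proof.
move=> f /pow_submodP Bf; rewrite (sum_delta f); apply: rpred_sum => v _.
apply: (join_sup (in_fullset v)); exact: mem_image_submod.
Qed.

End Delta.

Lemma image_submod_join (R : pzRingType) (U V : lmodType R)
    (f : {linear U -> V}) (I : choiceType) (T : I -> submodClosed U) (S : {fset I}) :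
  subsm (image_submod f (join T S)) (join (fun i => image_submod f (T i)) S).
Proof.
move=> _ /image_submodP[x xT <-]; move: x xT; apply: gen_submod_map.
by move=> x [i iS Tx]; apply: (join_sup iS); apply: mem_image_submod.
Qed.

Section UpperBound.
Variables (K : realType) (R : pzRingType) (L : lmodType R -> \bar K).
Hypothesis hL : length_function L.
Variables (Gamma : groupType) (M : lmodType (group_ring R Gamma)).
Variables (d : nat) (sigma : Gamma -> 'S_d).
Variables (A : submodClosed (restr M)) (E : {fset Gamma}).
Hypothesis finA : finl L A.

Lemma finl_sofic_mod B F : finl L (sofic_mod A B F sigma).
Proof. by apply: (finl_image hL); apply: (finl_pow hL). Qed.

Lemma len_sofic_mod_le B F : len L (sofic_mod A B F sigma) <= d%:R * len L A.
Proof.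
rewrite -(len_pow hL _ finA); apply: (len_image_le hL); exact: (finl_pow hL).
Qed.

(** For [a] in [A] and [s] in [E], the relation with coefficient [s^-1 a] at [v]
    identifies [a] at the point [sigma s v] with [s^-1 a] at [v].  Hence the
    copies of [A] at the points of [E v] all lie in the copy of [A^E] at [v]. *)
Lemma sofic_mod_upper (good : pred 'I_d) :
  (forall v, good v -> {in E &, injective (fun s => sigma s v)}) ->
  #|` E|%:R * len L (sofic_mod A (translates A E) E sigma) <=
  d%:R * len L (translates A E) +
    #|` E|%:R * (#|[pred v | ~~ good v]|%:R * len L A).
Proof.
move=> injE; set rel := sofic_rel (translates A E) E sigma.
pose T v := image_submod (quot_proj rel) (delta_submod A v).
have finT v : finl L (T v) by do 2!apply: (finl_image hL).
have finAE : finl L (translates A E) by apply: finl_translates.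
have finI v : finl L (image_submod (quot_proj rel)
    (delta_submod (translates A E) v)) by do 2!apply: (finl_image hL).
apply: (@le_trans _ _ (#|` E|%:R * len L (join T (fullset d)))).
  rewrite ler_wpM2l // len_le //; last exact: finl_join.
  move=> _ /image_submodP[x /pow_submod_join xA <-].
  by apply: image_submod_join; apply: mem_image_submod.
apply: (len_join_perm_cover hL (sigma := sigma)) => // [v||v gv].
- by apply: le_trans (len_image_le hL _ _) (len_image_le hL _ _) => //; apply: (finl_image hL).
- exact: len_ge0.
apply: (@le_trans _ _ (len L (image_submod (quot_proj rel)
    (delta_submod (translates A E) v)))); last first.
  apply: le_trans (len_image_le hL _ _) _; first exact: (finl_image hL).
  exact: len_image_le.
apply: len_le => //; apply: join_sub => _ /imfsetP[s /= sE ->].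
move=> _ /image_submodP[_ /image_submodP[a aA <-] <-].
have bE : gact s^-1%g a \in translates A E by apply: in_translates.
apply/image_submodP; exists (delta v (gact s^-1%g a)).
  exact: mem_image_submod.
apply/quot_projP; apply: mem_gen_submod.
by exists v, (gact s^-1%g a), s; split=> //=; rewrite gactVK.
Qed.

End UpperBound.

(** * Finitely supported chains *)

Section Chains.
Variables (R : pzRingType) (Gamma : groupType).
Variable M : lmodType (group_ring R Gamma).
Variables (d : nat) (sigma : Gamma -> 'S_d).
Local Notation U := {ffun 'I_d -> restr M}.
Local Notation chain := (Gamma -> restr M).
Implicit Types (B : submodClosed (restr M)) (E : {fset Gamma}) (n : chain).

(** A chain of finite support represents an element of the module induced from
    [M] as an R-module, the value [x] at [e] standing for [e^-1] tensored with
    [x]: [total] is the canonical map to [M], and [spread] places the value at [e]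
    over the point [sigma e v] of the finite model. *)
Definition single (e : Gamma) (x : restr M) : chain :=
  fun s => if s == e then x else 0.

Definition total E n : restr M := \sum_(e <- E) gact e^-1%g (n e).

Definition spread E (v : 'I_d) n : U := \sum_(e <- E) delta (sigma e v) (n e).

Lemma total_linear E : linear (total E).
Proof.
move=> a m n; rewrite /total scaler_sumr -big_split; apply: eq_bigr => e _.
exact: linearP.
Qed.

HB.instance Definition _ E := GRing.isLinear.Build R chain (restr M) *:%R
  (total E) (total_linear E).

Lemma spread_linear E v : linear (spread E v).
Proof.
move=> a m n; rewrite /spread scaler_sumr -big_split; apply: eq_bigr => e _.
exact: linearP.
Qed.

HB.instance Definition _ E v := GRing.isLinear.Build R chain U *:%R
  (spread E v) (spread_linear E v).

Lemma totalB E m n : total E (m - n) = total E m - total E n.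
Proof. exact: (raddfB (total E : {additive chain -> restr M})). Qed.

Lemma total_sum E (I : Type) (r : seq I) (m : I -> chain) :
  total E (\sum_(i <- r) m i) = \sum_(i <- r) total E (m i).
Proof. exact: linear_sum. Qed.

Lemma spreadB E v m n : spread E v (m - n) = spread E v m - spread E v n.
Proof. exact: (raddfB (spread E v : {additive chain -> U})). Qed.

Lemma spread_sum E v (I : Type) (r : seq I) (m : I -> chain) :
  spread E v (\sum_(i <- r) m i) = \sum_(i <- r) spread E v (m i).
Proof. exact: linear_sum. Qed.

Lemma big_single (V : zmodType) (F : Gamma -> restr M -> V) E e x :
  (forall s, F s 0 = 0) -> e \in E ->
  \sum_(s <- E) F s (single e x s) = F e x.
Proof.
move=> F0 eE; rewrite (bigD1_seq e) ?fset_uniq //= /single eqxx.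
by rewrite big1 ?addr0 // => s /negPf ->.
Qed.

Lemma total_single E e x : e \in E -> total E (single e x) = gact e^-1%g x.
Proof.
move=> eE; apply: (big_single (F := fun s y => gact s^-1%g y)) => // s.
exact: linear0.
Qed.

Lemma spread_single E v e x :
  e \in E -> spread E v (single e x) = delta (sigma e v) x.
Proof.
move=> eE; apply: (big_single (F := fun s y => delta (sigma s v) y)) => // s.
exact: linear0.
Qed.

Lemma single_supp B E e x : e \in E -> x \in B -> single e x \in supp_submod B E.
Proof.
move=> eE xB; apply/supp_submodP => s; rewrite /single.
by case: eqP => [->|_]; [rewrite eE | rewrite rpred0].
Qed.

Lemma total_translates B E n : n \in supp_submod B E -> total E n \in translates B E.
Proof.
move=> /supp_submodP nE; rewrite /total big_seq; apply: rpred_sum => e eE.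
by apply: in_translates => //; case: (nE e).
Qed.

Lemma total_surj B E y :
  y \in translates B E -> exists2 n, n \in supp_submod B E & total E n = y.
Proof.
suff sub : subsm (translates B E) (image_submod (total E) (supp_submod B E)).
  by move=> /sub /image_submodP.
apply: gen_submod_sub => _ [s [a [sE aB ->]]]; apply/image_submodP.
by exists (single s a); [apply: single_supp | apply: total_single].
Qed.

(** The relations between the translates of [B] by [E]. *)
Definition cycles B E := capsm (supp_submod B E) (kersm (total E)).

Lemma cyclesP B E n : n \in cycles B E <-> n \in supp_submod B E /\ total E n = 0.
Proof.
split=> [/capsmP[nB /kersmP]|[nB n0]] //.
by apply/capsmP; split=> //; apply/kersmP.
Qed.

Lemma supp_mono B B' E E' : subsm B B' -> (E `<=` E')%fset ->
  subsm (supp_submod B E) (supp_submod B' E').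
Proof.
move=> BB' EE' n /supp_submodP nE; apply/supp_submodP => s.
have [nB n0] := nE s; split; first exact: BB'.
by move=> sE'; apply: n0; apply: contra sE'; apply: fsubsetP.
Qed.

Lemma total_mono B E E' n : (E `<=` E')%fset -> n \in supp_submod B E ->
  total E' n = total E n.
Proof.
move=> EE' /supp_submodP nE; symmetry; apply: big_fset_incl => // s _ sE.
by rewrite (nE s).2 //; apply: linear0.
Qed.

Lemma spread_mono B E E' v n : (E `<=` E')%fset -> n \in supp_submod B E ->
  spread E' v n = spread E v n.
Proof.
move=> EE' /supp_submodP nE; symmetry; apply: big_fset_incl => // s _ sE.
by rewrite (nE s).2 //; apply: linear0.
Qed.

Lemma cycles_mono B E E' : (E `<=` E')%fset -> subsm (cycles B E) (cycles B E').
Proof.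
move=> EE' n /cyclesP[nB n0]; apply/cyclesP.
by split; [apply: supp_mono nB | rewrite (total_mono EE' nB)].
Qed.

(** Where [sigma] is multiplicative, moving the base point from [v] to
    [sigma s v] amounts to translating chains by [s] on the right. *)
Lemma spread_cycles_shift B E ES s v :
  (forall e, e \in E -> (e * s)%g \in ES) ->
  (forall e, e \in E -> sigma e (sigma s v) = sigma (e * s)%g v) ->
  subsm (image_submod (spread E (sigma s v)) (cycles B E))
        (image_submod (spread ES v) (cycles B ES)).
Proof.
move=> EsES mulE _ /image_submodP[n /cyclesP[nB n0] <-]; apply/image_submodP.
exists (\sum_(e <- E) single (e * s)%g (n e)); last first.
  rewrite raddf_sum /= [RHS]/spread; apply: eq_big_seq => e eE.
  by rewrite spread_single ?EsES // mulE.
have nE := nB; move/supp_submodP in nE.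
apply/cyclesP; split.
  rewrite big_seq; apply: rpred_sum => e eE.
  by apply: single_supp; [apply: EsES | case: (nE e)].
have -> : 0 = gact s^-1%g (total E n).
  by rewrite n0; symmetry; apply: linear0.
rewrite raddf_sum /= [in RHS]/total [RHS]raddf_sum /=; apply: eq_big_seq => e eE.
by rewrite total_single ?EsES // -gactM invgM.
Qed.

End Chains.

Section ChainLength.
Variables (K : realType) (R : pzRingType) (L : lmodType R -> \bar K).
Hypothesis hL : length_function L.
Variables (Gamma : groupType) (M : lmodType (group_ring R Gamma)).
Implicit Types (A B : submodClosed (restr M)) (E : {fset Gamma}).

Lemma finl_cycles B E : finl L B -> finl L (cycles B E).
Proof.
move=> finB; apply: (finl_le hL) (finl_supp hL E finB).
by move=> n /cyclesP[].
Qed.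

(** Rank and nullity of [total], which maps [B]-valued chains onto [B^E]. *)
Lemma len_cycles B E : finl L B ->
  len L (cycles B E) + len L (translates B E) = #|` E|%:R * len L B.
Proof.
move=> finB; rewrite -len_supp //; apply: EFin_inj.
rewrite EFinD -!finlE //; try by [apply: finl_cycles|apply: finl_supp|apply: finl_translates].
symmetry; apply: (length_kernel hL (f := total E)).
- exact: total_translates.
- exact: total_surj.
- by move=> n; apply: cyclesP.
Qed.

(** The submodule on the right consists of the chains whose total lies in [A^E];
    its two summands meet in cycles with values in [A], and the length of those
    is given by rank and nullity. *)
Lemma len_cycles_over A B E : finl L B -> subsm A B ->
  len L (cycles B E) + len L (translates A E) <=
  len L (addsm (cycles B E) (supp_submod A E)).
Proof.
move=> finB AB; have finA := finl_le hL AB finB.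
have finC := finl_cycles E finB.
have finS := finl_supp hL E finA.
have eqM := len_modular hL finC finS.
have eqA := len_cycles E finA; rewrite -len_supp // in eqA.
have leC : len L (capsm (cycles B E) (supp_submod A E)) <= len L (cycles A E).
  apply: len_le; [exact: hL| |exact: finl_cycles].
  by move=> n /capsmP[/cyclesP[_ n0] nA]; apply/cyclesP.
by rewrite -(lerD2r (len L (cycles A E))) -addrA [X in _ + X]addrC eqA -eqM lerD2l.
Qed.

End ChainLength.

(** * Relations of a finite model as cycles *)

Lemma submodB (R : pzRingType) (U : lmodType R) (N : submodClosed U) x y :
  x \in N -> y \in N -> x - y \in N.
Proof. by move=> Nx Ny; rewrite rpredD // submod_oppr. Qed.

Section Relations.
Variables (R : pzRingType) (Gamma : groupType).
Variable M : lmodType (group_ring R Gamma).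
Variables (d : nat) (sigma : Gamma -> 'S_d).
Local Notation U := {ffun 'I_d -> restr M}.
Implicit Types (B : submodClosed (restr M)) (E F : {fset Gamma}).

Definition edge (s : Gamma) (v : 'I_d) (x : restr M) : U :=
  delta v x - delta (sigma s v) (gact s x).

Lemma edge_linear s v : linear (edge s v).
Proof.
move=> a x y; rewrite /edge gact_linear !delta_linear scalerBr opprD.
by rewrite addrACA.
Qed.

HB.instance Definition _ s v := GRing.isLinear.Build R (restr M) U *:%R
  (edge s v) (edge_linear s v).

Lemma sofic_rel_sum B F z : z \in sofic_rel B F sigma ->
  exists2 b : 'I_d -> Gamma -> restr M, (forall v s, b v s \in B) &
    z = \sum_v \sum_(s <- F) edge s v (b v s).
Proof.
pose P : set U := fun z => exists2 b : 'I_d -> Gamma -> restr M,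
  (forall v s, b v s \in B) & z = \sum_v \sum_(s <- F) edge s v (b v s).
have edge0 s v : edge s v 0 = 0 by apply: linear0.
have P0 : P 0.
  exists (fun _ _ => 0) => [v s|]; first exact: rpred0.
  by rewrite big1 // => v _; rewrite big1 // => s _; apply: edge0.
have PD x y : P x -> P y -> P (x + y).
  move=> [b bB ->] [c cB ->]; exists (fun v s => b v s + c v s).
    by move=> v s; apply: rpredD.
  rewrite -big_split; apply: eq_bigr => v _; rewrite -big_split.
  by apply: eq_bigr => s _; rewrite linearD.
have PZ a x : P x -> P (a *: x).
  move=> [b bB ->]; exists (fun v s => a *: b v s).
    by move=> v s; apply: rpredZ.
  rewrite scaler_sumr; apply: eq_bigr => v _; rewrite scaler_sumr.
  by apply: eq_bigr => s _; rewrite linearZ.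
suff sub : subsm (sofic_rel B F sigma) (submod_of P0 PD PZ).
  by move=> /sub /in_submod_of.
apply: gen_submod_sub => _ [v [x [s [xB sF ->]]]]; apply/in_submod_of.
exists (fun w t => if (w == v) && (t == s) then x else 0).
  by move=> w t; case: ifP => // _; apply: rpred0.
rewrite (bigD1 v) //= (bigD1_seq s) ?fset_uniq //= !eqxx /=.
rewrite big1 => [|t /negPf ts]; last by rewrite ts edge0.
rewrite addr0 big1 ?addr0 // => w /negPf wv.
by rewrite big1 // => t _; rewrite wv edge0.
Qed.

Lemma delta_sum (I : Type) (r : seq I) (f : I -> restr M) (v : 'I_d) :
  delta v (\sum_(i <- r) f i) = \sum_(i <- r) delta v (f i).
Proof. exact: linear_sum. Qed.

Lemma deltaB (v : 'I_d) (x y : restr M) :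
  delta v (x - y) = delta v x - delta v y.
Proof. exact: (raddfB (@delta R Gamma M d v : {additive restr M -> U})). Qed.

Lemma sum_deltaE (f : 'I_d -> restr M) w : (\sum_v delta v (f v)) w = f w.
Proof.
rewrite sum_ffunE (bigD1 w) //= ffunE eqxx big1 ?addr0 // => v vw.
by rewrite ffunE eq_sym (negPf vw).
Qed.

(** Makes [sigma s^-1 w] the point at which a relation along [s] ending at [w]
    starts. *)
Definition multiplicative_at F (w : 'I_d) : bool :=
  (sigma 1%g w == w) && all (fun s => sigma s (sigma s^-1%g w) == w) F.

Definition ball F (w : 'I_d) : {fset 'I_d} :=
  (w |` [fset ((sigma s)^-1)%g w | s in F])%fset.

Lemma card_ball F w : (#|` ball F w| <= #|` F|.+1)%N.
Proof.
rewrite cardfsU1; apply: (leq_add (leq_b1 _)).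
by apply: leq_trans (leq_imfset_card _ _ _) _.
Qed.

(** At the few points where [sigma] is not multiplicative a crude submodule that
    contains all relations ending at [w] is enough: its length is bounded
    independently of [d]. *)
Definition local_rel B E F (w : 'I_d) : submodClosed U :=
  if multiplicative_at F w then image_submod
    (@spread R Gamma M d sigma E w : {linear (Gamma -> restr M) -> U}) (cycles B E)
  else image_submod (@fun_ffun R 'I_d (restr M)) (supp_submod B (ball F w)).

(** Regroup a sum of relations by their end points.  The relations ending at [w]
    contribute [p w], whose coordinate at [w] is minus a combination [c w] of
    translates by [F].  A single [c w] could leave [B], but the sum has
    coordinates in [B], which forces every [c w] into [B]; so [p w] is the image
    of a cycle supported on [F^-1] and [1]. *)
Lemma sofic_rel_local B0 B E F : subsm B0 B -> 1%g \in E ->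
  (forall s, s \in F -> s^-1%g \in E) ->
  forall z, z \in sofic_rel B0 F sigma -> z \in pow_submod B d ->
  z \in join (local_rel B E F) (fullset d).
Proof.
move=> B0B E1 FE z /sofic_rel_sum[b bB0 zE] /pow_submodP zB.
have bB v s : b v s \in B by apply: B0B.
pose pre s w := ((sigma s)^-1)%g w.
pose c w := \sum_(s <- F) gact s (b (pre s w) s).
pose p w := \sum_(s <- F) delta (pre s w) (b (pre s w) s) - delta w (c w).
pose X := \sum_v \sum_(s <- F) delta v (b v s).
have X1 : X = \sum_w \sum_(s <- F) delta (pre s w) (b (pre s w) s).
  rewrite /X exchange_big [RHS]exchange_big /=; apply: eq_bigr => s _.
  by rewrite (reindex_inj (@perm_inj _ (sigma s)^-1%g)).
have X2 : X = \sum_v delta v (\sum_(s <- F) b v s).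
  by apply: eq_bigr => v _; rewrite delta_sum.
have zX : z = X - \sum_w delta w (c w).
  rewrite zE /edge; under eq_bigr do rewrite sumrB.
  rewrite sumrB; congr (_ - _).
  under [RHS]eq_bigr do rewrite /c delta_sum.
  rewrite exchange_big [RHS]exchange_big /=; apply: eq_bigr => s _.
  rewrite (reindex_inj (@perm_inj _ (sigma s)^-1%g)) /=.
  by apply: eq_bigr => w _; rewrite permKV.
have zp : z = \sum_w p w by rewrite zX X1 -sumrB.
have cB w : c w \in B.
  have zw : z w = \sum_(s <- F) b w s - c w.
    rewrite -[RHS](sum_deltaE (fun v => \sum_(s <- F) b v s - c v)).
    rewrite zX X2 -sumrB; congr (fun_of_fin _ w).
    by apply: eq_bigr => v _; rewrite deltaB.
  have -> : c w = \sum_(s <- F) b w s - z w by rewrite zw opprB addrC subrK.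
  by rewrite submodB // rpred_sum.
rewrite zp; apply: rpred_sum => w _; apply: (join_sup (in_fullset w)).
rewrite /local_rel; case: ifP => [/andP[/eqP s1 /allP sF]|_].
  apply/image_submodP.
  exists (\sum_(s <- F) single s^-1%g (b (pre s w) s) - single 1%g (c w)).
    apply/cyclesP; split.
      apply: submodB; last exact: single_supp.
      by rewrite big_seq rpred_sum // => s sF'; apply: single_supp => //; apply: FE.
    rewrite /= totalB total_sum total_single // invg1 gact1.
    rewrite /c -sumrB big1_seq // => s /= sF'.
    by rewrite total_single ?FE // invgK subrr.
  rewrite /= spreadB spread_sum spread_single // s1; congr (_ - _).
  apply: eq_big_seq => s sF'; rewrite spread_single ?FE //.
  have -> // : pre s w = sigma s^-1%g w.
  by apply: (@perm_inj _ (sigma s)); rewrite /pre permKV (eqP (sF s sF')).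
have deltaBall u x : u \in ball F w -> x \in B -> delta u x \in
    image_submod (@fun_ffun R 'I_d (restr M)) (supp_submod B (ball F w)).
  move=> uw xB; apply/image_submodP; exists (fun v => if v == u then x else 0).
    apply/supp_submodP => v; case: eqP => [->|_]; first by rewrite uw.
    by rewrite rpred0.
  by apply/ffunP => v; rewrite !ffunE.
apply: submodB; last by apply: deltaBall; rewrite ?fset1U1.
rewrite big_seq; apply: rpred_sum => s sF; apply: deltaBall => //.
by rewrite in_fset1U; apply/orP; right; apply/imfsetP; exists s.
Qed.

End Relations.

(** * The lower bound in a finite model *)

Section LowerBound.
Variables (K : realType) (R : pzRingType) (L : lmodType R -> \bar K).
Hypothesis hL : length_function L.
Variables (Gamma : groupType) (M : lmodType (group_ring R Gamma)).
Variables (d : nat) (sigma : Gamma -> 'S_d).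
Variables (A B : submodClosed (restr M)).
Hypotheses (finB : finl L B) (AB : subsm A B).
Local Notation U := {ffun 'I_d -> restr M}.
Local Notation chain := (Gamma -> restr M).
Implicit Types (E F P S : {fset Gamma}).

Let finA : finl L A. Proof. exact: finl_le finB. Qed.

Lemma finl_local_rel E F w : finl L (local_rel sigma B E F w).
Proof.
rewrite /local_rel; case: ifP => _; apply: (finl_image hL).
  exact: finl_cycles.
exact: finl_supp.
Qed.

Lemma len_cycles_le E : len L (cycles B E) <= #|` E|%:R * len L B.
Proof. by rewrite -(len_cycles hL E finB) lerDl len_ge0. Qed.

Lemma len_local_rel E F w :
  len L (local_rel sigma B E F w) <= (#|` E| + #|` F|.+1)%:R * len L B.
Proof.
rewrite natrD mulrDl /local_rel; case: ifP => _.
  apply: le_trans (len_image_le hL _ _) _; first exact: finl_cycles.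
  by apply: le_trans (len_cycles_le E) _; rewrite lerDl mulr_ge0 ?ler0n ?len_ge0.
apply: le_trans (len_image_le hL _ _) _; first exact: finl_supp.
rewrite len_supp //; apply: (@le_trans _ _ (#|` F|.+1%:R * len L B)).
  by rewrite ler_wpM2r ?len_ge0 // ler_nat card_ball.
by rewrite lerDr mulr_ge0 ?ler0n ?len_ge0.
Qed.

(** Around a good [v], the local relations at the points [sigma s v], [s] in [S],
    are all images of cycles over the single set [E S] based at [v]. *)
Lemma len_join_local_rel E F S (good : pred 'I_d) :
  (forall v, good v -> {in S &, injective (fun s => sigma s v)}) ->
  (forall v s, good v -> s \in S -> multiplicative_at sigma F (sigma s v)) ->
  (forall v s e, good v -> s \in S -> e \in E ->
     sigma e (sigma s v) = sigma (e * s)%g v) ->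
  #|` S|%:R * len L (join (local_rel sigma B E F) (fullset d)) <=
  d%:R * len L (cycles B [fset (e * s)%g | e in E, s in S]%fset) +
    #|` S|%:R * (#|[pred v | ~~ good v]|%:R *
      ((#|` E| + #|` F|.+1)%:R * len L B)).
Proof.
move=> injS multF multE; set ES := [fset _ | e in E, s in S]%fset.
have finT := finl_local_rel E F.
apply: (len_join_perm_cover hL (sigma := sigma)) => // [w||v gv].
- exact: len_local_rel.
- exact: len_ge0.
apply: (@le_trans _ _ (len L (image_submod
    (spread sigma ES v : {linear chain -> U}) (cycles B ES)))); last first.
  by apply: (len_image_le hL); apply: finl_cycles.
apply: len_le => //; last by apply: (finl_image hL); apply: finl_cycles.
apply: join_sub => _ /imfsetP[s /= sS ->].
rewrite /local_rel multF //; apply: spread_cycles_shift => e eE.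
  by apply/imfset2P; exists e => //; exists s.
exact: multE.
Qed.

(** Over [P v], chains with values in [B] map onto the span of the copies of [B];
    those whose total lies in [A^P] differ from [A]-valued chains by cycles, and
    so vanish modulo [Q].  What remains is a quotient of [B^P / A^P]. *)
Lemma len_translates_quotient (Q : submodClosed U) P v :
  (forall n : chain, n \in cycles B P -> spread sigma P v n \in Q) ->
  subsm (pow_submod A d) Q ->
  len L (join (fun w => image_submod (quot_proj Q) (delta_submod B w))
              [fset sigma s v | s in P]%fset) + len L (translates A P) <=
  len L (translates B P).
Proof.
move=> cycQ AQ.
pose f : {linear chain -> quot_mod Q} := quot_proj Q \o spread sigma P v.
have finS := finl_supp hL P finB.
have := len_image_kernel hL (f := f) finS (N' := addsm (cycles B P) (supp_submod A P)).
have sub1 : subsm (addsm (cycles B P) (supp_submod A P)) (supp_submod B P).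
  by apply: addsm_sub => n; [move=> /cyclesP[]|apply: supp_mono].
have ker1 n : n \in addsm (cycles B P) (supp_submod A P) -> f n = 0.
  move=> /addsmP[n1 [n2 [n1c n2A ->]]].
  rewrite linearD; have -> : f n1 = 0 by apply/quot_proj_eq0/cycQ.
  rewrite add0r; apply/quot_proj_eq0/AQ/pow_submodP => w.
  rewrite /spread sum_ffunE; apply: rpred_sum => e _.
  by rewrite ffunE; case: eqP => // _; rewrite ?rpred0 //; move/supp_submodP: n2A => /(_ e)[].
move=> /(_ sub1 ker1) le1.
have le2 := len_cycles_over hL P finB AB.
have eqB := len_cycles hL P finB.
rewrite len_supp // -eqB in le1.
have le3 : len L (join (fun w => image_submod (quot_proj Q) (delta_submod B w))
              [fset sigma s v | s in P]%fset) <=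
    len L (image_submod f (supp_submod B P)).
  apply: len_le => //; last exact: (finl_image hL).
  apply: join_sub => _ /imfsetP[s /= sP ->].
  move=> _ /image_submodP[_ /image_submodP[a aB <-] <-].
  apply/image_submodP; exists (single s a); first exact: single_supp.
  by rewrite /f /= spread_single.
rewrite -(lerD2l (len L (cycles B P))).
apply: le_trans le1; rewrite addrCA.
exact: lerD.
Qed.

(** The covering inequality for the copies of [B] modulo [A^d + Z], where [Z] is
    generated by the local relations. *)
Lemma len_pow_quotient E F P (good : pred 'I_d) :
  (P `<=` E)%fset -> P != fset0 ->
  (forall v, good v -> {in P &, injective (fun s => sigma s v)}) ->
  (forall v, good v -> multiplicative_at sigma F v) ->
  #|` P|%:R * (d%:R * len L B) + d%:R * len L (translates A P) <=
  #|` P|%:R * len L (addsm (pow_submod A d)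
                      (join (local_rel sigma B E F) (fullset d))) +
  (d%:R * len L (translates B P) +
    #|` P|%:R * (#|[pred v | ~~ good v]|%:R * len L B)).
Proof.
move=> PE P0 injP multF; set Z := join _ _; set Q := addsm _ Z.
pose T (w : 'I_d) := image_submod (quot_proj Q) (delta_submod B w).
have finT w : finl L (T w) by do 2!apply: (finl_image hL).
have finQ : finl L Q.
  apply: finl_add => //; first exact: finl_pow.
  by apply: finl_join => // w _; apply: finl_local_rel.
have cov : #|` P|%:R * len L (join T (fullset d)) <=
    d%:R * (len L (translates B P) - len L (translates A P)) +
    #|` P|%:R * (#|[pred v | ~~ good v]|%:R * len L B).
  apply: (len_join_perm_cover hL (sigma := sigma)) => // [w||v gv].
  - by apply: le_trans (len_image_le hL _ _) (len_image_le hL _ _) => //;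
      apply: (finl_image hL).
  - rewrite subr_ge0; apply: len_le => //; last exact: finl_translates.
    exact: translates_mono.
  rewrite lerBrDr; apply: len_translates_quotient; last exact: addsm_subl.
  move=> n nc; apply/addsm_subr/(join_sup (in_fullset v)).
  rewrite /local_rel multF //; apply/image_submodP; exists n.
    exact: cycles_mono nc.
  by have /cyclesP[nB _] := nc; rewrite /= (spread_mono _ _ PE nB).
have finP := finl_pow hL d finB.
have split : d%:R * len L B <= len L Q + len L (join T (fullset d)).
  rewrite -(len_pow hL) // (len_proj hL Q finP); apply: lerD.
    by apply: len_le => // x /capsmP[].
  apply: len_le => //; last exact: finl_join.
  move=> _ /image_submodP[x /pow_submod_join xB <-].
  by apply: image_submod_join; apply: mem_image_submod.
have {}split := ler_wpM2l (ler0n K #|` P|) split.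
rewrite mulrDr in split; rewrite mulrBr in cov.
apply: le_trans (lerD split (lexx _)) _.
by rewrite -[leLHS]addrA lerD2l -lerBrDr addrAC.
Qed.

(** The sofic module is the quotient of [A^d] by the relations it contains, all of
    which lie in the join of the local relations. *)
Lemma len_sofic_mod_lower (B0 : submodClosed (restr M)) E F :
  subsm B0 B -> 1%g \in E -> (forall s, s \in F -> s^-1%g \in E) ->
  len L (addsm (pow_submod A d) (join (local_rel sigma B E F) (fullset d))) <=
  len L (sofic_mod A B0 F sigma) +
  len L (join (local_rel sigma B E F) (fullset d)).
Proof.
move=> B0B E1 FE; set Z := join _ _.
have finZ : finl L Z by apply: finl_join => // w _; apply: finl_local_rel.
have finP := finl_pow hL d finA.
have := len_modular hL finP finZ.
rewrite (len_proj hL (sofic_rel B0 F sigma) finP) -/(sofic_mod _ _ _ _) => eqM.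
rewrite -(lerD2r (len L (capsm (pow_submod A d) Z))) eqM.
rewrite [leRHS]addrC addrA !lerD2r.
apply: len_le => //; last by apply: (finl_le hL) finZ => x /capsmP[].
move=> x /capsmP[xA xrel]; apply/capsmP; split=> //.
apply: sofic_rel_local xrel _ => //.
by apply/pow_submodP => v; apply: AB; move/pow_submodP: xA.
Qed.

End LowerBound.

(** * Points where a sofic approximation behaves well *)

Section GoodPoints.
Variables (Gamma : groupType) (d : nat) (sigma : Gamma -> 'S_d).
Implicit Types (H : {fset Gamma}).

Definition good_at H (v : 'I_d) : bool :=
  all (fun s => all (fun t => (sigma s (sigma t v) == sigma (s * t)%g v) &&
                    ((s == t) || (sigma s v != sigma t v))) H) H.

Definition bad_count H : nat := #|[pred v | ~~ good_at H v]|.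

Lemma good_at_mul H v s t : good_at H v -> s \in H -> t \in H ->
  sigma s (sigma t v) = sigma (s * t)%g v.
Proof. by move=> /allP/[apply]/allP/[apply]/andP[/eqP]. Qed.

Lemma good_at_inj H E v : good_at H v -> (E `<=` H)%fset ->
  {in E &, injective (fun s => sigma s v)}.
Proof.
move=> gv /fsubsetP EH s t sE tE st.
have /allP/(_ _ (EH _ sE))/allP/(_ _ (EH _ tE)) := gv.
by rewrite st eqxx orbF => /andP[_ /eqP].
Qed.

Lemma good_at_multiplicative H F v : good_at H v -> 1%g \in H ->
  (forall s, s \in F -> s \in H /\ s^-1%g \in H) -> multiplicative_at sigma F v.
Proof.
move=> gv H1 FH; have s1 : sigma 1%g v = v.
  by apply: (@perm_inj _ (sigma 1%g)); rewrite (good_at_mul gv) // mulg1.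
rewrite /multiplicative_at s1 eqxx /=; apply/allP => s /FH[sH sVH].
by rewrite (good_at_mul gv) // mulgV s1.
Qed.

(** Goodness at [v] for a larger set gives multiplicativity at [sigma s v] as
    well, so bad points need not be transported along [sigma]. *)
Lemma good_at_multiplicative_shift H F S v s : good_at H v -> 1%g \in H ->
  s \in S -> (S `<=` H)%fset ->
  (forall t, t \in F -> t \in H /\ t^-1%g \in H) ->
  (forall t u, t \in F -> u \in S -> (t^-1 * u)%g \in H) ->
  multiplicative_at sigma F (sigma s v).
Proof.
move=> gv H1 sS /fsubsetP SH FH FSH; have sH := SH _ sS.
rewrite /multiplicative_at (good_at_mul gv) // mul1g eqxx /=.
apply/allP => t tF; have [tH tVH] := FH _ tF.
by rewrite (good_at_mul gv tVH) // (good_at_mul gv tH) ?FSH // mulVKg.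
Qed.

End GoodPoints.

Section ModelBounds.
Variables (K : realType) (R : pzRingType) (L : lmodType R -> \bar K).
Hypothesis hL : length_function L.
Variables (Gamma : groupType) (M : lmodType (group_ring R Gamma)).
Implicit Types (A B : submodClosed (restr M)) (E F H : {fset Gamma}).

Lemma sofic_mod_le_mean A e : finl L A -> 0 < e ->
  exists E C, forall (d : nat) (sigma : Gamma -> 'S_d),
    len L (sofic_mod A (translates A E) E sigma) <=
    d%:R * (mean_length L A + e) + (bad_count sigma E)%:R * C.
Proof.
move=> finA e0; have [E E0 leE] := mean_length_approx hL A e0.
exists E, (len L A) => d sigma.
have cE0 : 0 < (#|` E|%:R : K) by rewrite ltr0n cardfs_gt0.
rewrite -(ler_pM2l cE0) mulrDr mulrCA.
have := sofic_mod_upper hL (sigma := sigma) finA (good := good_at sigma E).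
move=> /(_ E (fun v gv => good_at_inj gv (fsubset_refl E))) /le_trans; apply.
by rewrite lerD2r ler_wpM2l.
Qed.

Hypothesis hGamma : amenable K Gamma.

Lemma mean_length_le_len A : finl L A -> mean_length L A <= len L A.
Proof.
move=> finA; have E0 : [fset 1%g]%fset != fset0 :> {fset Gamma}.
  by apply/eqP => /fsetP/(_ 1%g); rewrite !inE eqxx.
have := mean_length_le hL A E0; rewrite cardfs1 mul1r => /le_trans; apply.
apply: len_le => //; apply: gen_submod_sub => _ [s [a [+ aA ->]]].
by rewrite inE => /eqP ->; rewrite invg1 gact1.
Qed.

(** The error terms: [P] loses [e / 2] through the infimum for [B], and the
    Folner set [S] loses [e / 2] because [E S] is slightly larger than [S], which
    is multiplied by at most [L(B)].  Bad points cost a constant each. *)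
Lemma mean_le_sofic_mod A B0 F e : finl L A -> finl L B0 -> 0 < e ->
  exists H C, forall (d : nat) (sigma : Gamma -> 'S_d),
    d%:R * (mean_length L A - e) <=
    len L (sofic_mod A B0 F sigma) + (bad_count sigma H)%:R * C.
Proof.
move=> finA finB0 e0; pose B := addsm A B0.
have finB : finl L B by apply: finl_add.
have AB : subsm A B by apply: addsm_subl.
have B0B : subsm B0 B by apply: addsm_subr.
pose e2 := e / 2; have e20 : 0 < e2 by rewrite divr_gt0.
set mA := mean_length L A; set b := len L B; pose m := mean_length L B.
have b0 : 0 <= b by apply: len_ge0.
have m0 : 0 <= m by apply: mean_length_ge0.
have mb : m <= b by apply: mean_length_le_len.
have [P P0 leP] := mean_length_approx hL B e20.
pose E := (P `|` (1%g |` [fset s^-1%g | s in F]))%fset.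
have E1 : 1%g \in E by rewrite !inE eqxx orbT.
have E0 : E != fset0 by apply/fset0Pn; exists 1%g.
have FE s : s \in F -> s^-1%g \in E.
  by move=> sF; rewrite !inE; apply/or3P/Or33/imfsetP; exists s.
pose dl := e2 / (b + 1); have b10 : 0 < b + 1 by rewrite ltr_wpDl.
have dl0 : 0 < dl by rewrite divr_gt0.
have [S S0 invS] := hGamma E0 dl0.
have cP0 : 0 < (#|` P|%:R : K) by rewrite ltr0n cardfs_gt0.
have cS0 : 0 < (#|` S|%:R : K) by rewrite ltr0n cardfs_gt0.
(* Besides [E], [S] and [F], the products [t^-1 u] let [sigma t] be undone at the
   points [sigma u v]. *)
pose H := (E `|` (S `|` (F `|` [fset (t^-1 * u)%g | t in F, u in S])))%fset.
have EH : (E `<=` H)%fset by apply: fsubsetUl.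
have SH : (S `<=` H)%fset by apply/fsubsetP => s sS; rewrite !inE sS orbT.
have H1 : 1%g \in H by apply: (fsubsetP EH).
have FH s : s \in F -> s \in H /\ s^-1%g \in H.
  by move=> sF; split; [rewrite 3!inE sF !orbT | apply/(fsubsetP EH)/FE].
have FSH t u : t \in F -> u \in S -> (t^-1 * u)%g \in H.
  move=> tF uS; rewrite !inE; do 3!(apply/orP; right).
  by apply/imfset2P; exists t => //; exists u.
have PE : (P `<=` E)%fset by apply: fsubsetUl.
exists H, ((#|` E| + #|` F|.+1)%:R * b + b) => d sigma.
set bad := (bad_count sigma H)%:R.
set x := len L (sofic_mod A B0 F sigma).
set ES := [fset (e * s)%g | e in E, s in S]%fset.
set z := len L (join (local_rel sigma B E F) (fullset d)).
set q := len L (addsm (pow_submod A d) (join (local_rel sigma B E F) (fullset d))).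
have qxz : q <= x + z by apply: len_sofic_mod_lower.
have zS : z <= d%:R * ((1 + dl) * (b - m)) + bad * ((#|` E| + #|` F|.+1)%:R * b).
  rewrite -(ler_pM2l cS0) mulrDr.
  apply: le_trans (len_join_local_rel hL finB (S := S) (good := good_at sigma H) _ _ _) _.
  - by move=> v gv; apply: good_at_inj gv SH.
  - by move=> v s gv sS; apply: (good_at_multiplicative_shift gv H1 sS SH).
  - move=> v s t gv sS tE.
    by rewrite (good_at_mul gv) //; [apply: (fsubsetP EH) | apply: (fsubsetP SH)].
  rewrite lerD2r mulrCA ler_wpM2l //.
  have ES0 : ES != fset0.
    have [s sS] := fset0Pn _ S0; apply/fset0Pn; exists (1 * s)%g.
    by apply/imfset2P; exists 1%g => //; exists s.
  have eqC := len_cycles hL ES finB.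
  have leC : len L (cycles B ES) <= #|` ES|%:R * (b - m).
    rewrite mulrBr -eqC -addrA lerDl subr_ge0.
    exact: mean_length_le.
  apply: le_trans leC _; rewrite mulrA ler_wpM2r ?subr_ge0 //.
  apply: (@le_trans _ _ (#|` S|%:R + #|` ES `\` S|%fset%:R)).
    by rewrite -natrD ler_nat card_translates_le.
  by rewrite mulrDr mulr1 lerD2l mulrC ltW.
have qP : d%:R * b + d%:R * mA <= q + (d%:R * (m + e2) + bad * b).
  rewrite -(ler_pM2l cP0) mulrDr [leRHS]mulrDr [X in _ <= _ + X]mulrDr.
  apply: le_trans (le_trans (lerD (lexx _) _) (len_pow_quotient hL finB AB
     (good := good_at sigma H) PE P0 _ _)) _.
  - by rewrite mulrCA ler_wpM2l // mean_length_le.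
  - move=> v gv; apply: good_at_inj gv _; exact: fsubset_trans EH.
  - by move=> v gv; apply: good_at_multiplicative gv H1 FH.
  by rewrite lerD2l lerD2r [leRHS]mulrCA ler_wpM2l.
have dlb : dl * (b - m) <= e2.
  apply: (@le_trans _ _ (dl * (b + 1))); last by rewrite /dl divfK // gt_eqF.
  by apply: ler_wpM2l; [apply: ltW | rewrite lerD2l (le_trans _ ler01) ?oppr_le0].
have key : (1 + dl) * (b - m) + (m + e2) <= b + e.
  rewrite mulrDl mul1r addrAC -addrA addrA addrA subrK -addrA lerD2l.
  by rewrite [e]splitr lerD2l.
have total : d%:R * b + d%:R * mA <=
    x + (d%:R * (b + e) + bad * ((#|` E| + #|` F|.+1)%:R * b + b)).
  apply: le_trans qP _; apply: le_trans (lerD (le_trans qxz (lerD (lexx _) zS)) (lexx _)) _.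
  rewrite -addrA lerD2l addrACA -mulrDr -mulrDr lerD2r.
  by rewrite ler_wpM2l.
rewrite -(lerD2l (d%:R * b)) mulrBr addrA; rewrite lerBlDr.
apply: le_trans total _; rewrite mulrDr.
by rewrite addrCA addrAC.
Qed.

End ModelBounds.

(** * Limits along the ultrafilter *)

Local Open Scope classical_set_scope.

Lemma ultra_map (T U : Type) (f : T -> U) (F : set_system T) :
  UltraFilter F -> UltraFilter (f @ F).
Proof.
move=> FU; split=> [|G GP sub]; first exact: fmap_proper_filter.
apply/seteqP; split=> [A GA|]; last exact: sub.
have [//|FnA] := in_ultra_setVsetC (f @^-1` A) FU.
have GnA : G (~` A) by apply: sub.
have GAnA : G (A `&` ~` A) by apply: filterI.
by have [? []] := @filter_ex _ _ GP _ GAnA.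
Qed.

(** Compactness of a segment. *)
Lemma ultra_cvg_bounded (K : realType) (T : Type) (F : set_system T)
    (f : T -> K) (a b : K) : UltraFilter F ->
  (forall x, a <= f x <= b) -> cvg ((f x)%:E @[x --> F]).
Proof.
move=> FU fab; have fU := ultra_map f FU.
have := @segment_compact K a b; rewrite compact_ultra => /(_ _ fU)[|l [_ fl]].
  by apply: (@filterE _ F) => x; rewrite /= in_itv /= fab.
by apply/cvg_ex; exists l%:E; apply: cvg_EFin => //; apply: nearW.
Qed.

Lemma tails_filter (J : Type) (le : J -> J -> Prop) :
  directed le -> Filter (tails le).
Proof.
move=> hJ; apply: filter_from_filter.
  by have [j _] := directed_ex hJ; exists j.
move=> i j _ _; have [k ik jk] := directed_ub hJ i j.
by exists k => // l kl; split; [apply: (directed_trans hJ) ik kl|apply: (directed_trans hJ) jk kl].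
Qed.

Section Negligible.
Variables (K : realType) (Gamma : groupType) (J : Type) (le : J -> J -> Prop).
Hypothesis hJ : directed le.
Variables (d : J -> nat) (sigma : forall i, Gamma -> 'S_(d i)).
Hypothesis hsigma : sofic_net K le sigma.
Variable F : set_system J.
Hypotheses (FF : ProperFilter F) (tailsF : tails le `<=` F).

Definition negligible (W : forall i, pred 'I_(d i)) :=
  forall e : K, 0 < e -> \forall i \near F, #|W i|%:R <= e * (d i)%:R.

Lemma negligible_has (T : eqType) (r : seq T) (W : T -> forall i, pred 'I_(d i)) :
  (forall x, x \in r -> negligible (W x)) ->
  negligible (fun i v => has (fun x => W x i v) r).
Proof.
elim: r => [_|x r IH Wr] e e0.
  by apply: nearW => i; rewrite /= eq_card0 // mulr_ge0 // ltW.
have e20 : 0 < e / 2 by rewrite divr_gt0.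
have /IH/(_ _ e20) near_r : forall y, y \in r -> negligible (W y).
  by move=> y yr; apply: Wr; rewrite inE yr orbT.
have near_x := Wr x (mem_head _ _) _ e20.
apply: filterS2 near_x near_r => i lex ler.
rewrite [e]splitr mulrDl; apply: le_trans (lerD lex ler).
rewrite -natrD ler_nat -cardUI -[leqLHS]addn0 leq_add //.
Qed.

Lemma negligible_cvg1 (W : forall i, pred 'I_(d i)) :
  (#|[set v | W i v]%SET|%:R / (d i)%:R : K) @[i --> tails le] --> (1 : K) ->
  negligible (fun i v => ~~ W i v).
Proof.
move=> W1 e e0.
move: W1 => /(@cvgrPdist_lt _ _ _ _ (tails_filter hJ))/(_ e e0)/tailsF nearW1.
apply: filterS nearW1 => i; rewrite cardsE.
have d0 : 0 < ((d i)%:R : K) by rewrite ltr0n (sofic_gt0 hsigma).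
move=> lt1; have : 1 - #|W i|%:R / (d i)%:R <= e.
  by apply: le_trans (ltW lt1); apply: ler_norm.
rewrite -(ler_pM2r d0) mulrBl mul1r divfK ?gt_eqF //; apply: le_trans.
rewrite lerBrDr -natrD ler_nat -[leqRHS]card_ord.
rewrite addnC -(cardC (W i)) leq_add2l.
exact/eq_leq/eq_card.
Qed.

(** A bad point fails one of finitely many conditions, each of which holds with
    density tending to one. *)
Lemma bad_negligible H : negligible (fun i v => ~~ good_at (sigma i) H v).
Proof.
suff : negligible (fun i v => has (fun s => has (fun t =>
    ~~ ((sigma i s (sigma i t v) == sigma i (s * t)%g v) &&
        ((s == t) || (sigma i s v != sigma i t v)))) H) H).
  move=> neg e e0; apply: filterS (neg e e0) => i; apply: le_trans.
  rewrite ler_nat; apply/eq_leq/eq_card => v; rewrite unfold_in [RHS]unfold_in /= /good_at.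
  by rewrite -has_predC; apply: eq_has => s; rewrite /= -has_predC.
apply: negligible_has => s sH; apply: negligible_has => t tH e e0.
have e20 : 0 < e / 2 by rewrite divr_gt0.
have mul := negligible_cvg1
  (W := fun i v => sigma i s (sigma i t v) == sigma i (s * t)%g v) (sofic_mul hsigma s t) e20.
have [st|st] := eqVneq s t.
  apply: filterS mul => i le1; apply: le_trans (le_trans le1 _).
    by rewrite ler_nat; apply/subset_leq_card/fintype.subsetP => v; rewrite !unfold_in /= andbT.
  by rewrite ler_wpM2r // [leRHS]splitr lerDl ltW.
have free := negligible_cvg1 (W := fun i v => sigma i s v != sigma i t v)
  (sofic_free hsigma st) e20.
apply: filterS2 mul free => i le1 le2.
rewrite [e]splitr mulrDl; apply: le_trans (lerD le1 le2).
rewrite -natrD ler_nat -cardUI -[leqLHS]addn0 leq_add //.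
by apply/subset_leq_card/fintype.subsetP => v; rewrite !unfold_in /= negb_and.
Qed.

Lemma near_bad_count H (C e : K) : 0 < e ->
  \forall i \near F, (bad_count (sigma i) H)%:R * C <= e * (d i)%:R.
Proof.
move=> e0; have C0 : 0 < `|C| + 1 by rewrite ltr_wpDl.
have eC0 : 0 < e / (`|C| + 1) by rewrite divr_gt0.
apply: filterS (bad_negligible H eC0) => i /= lebad.
apply: (@le_trans _ _ ((bad_count (sigma i) H)%:R * (`|C| + 1))).
  by rewrite ler_wpM2l // (le_trans (ler_norm C)) // lerDl.
apply: (@le_trans _ _ (e / (`|C| + 1) * (d i)%:R * (`|C| + 1))).
  by rewrite ler_wpM2r // ltW.
by rewrite mulrAC divfK // gt_eqF.
Qed.

End Negligible.

Section Generators.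
Variables (R : pzRingType) (Gamma : groupType).
Variable M : lmodType (group_ring R Gamma).

Lemma fin_gen_translates (A : submodClosed (restr M)) (E : {fset Gamma}) :
  fin_gen A -> fin_gen (translates A E).
Proof.
move=> [s As]; pose r := [seq gact e^-1%g a | e <- enum_fset E, a <- s].
exists r => x; apply/idP/idP.
  apply: gen_submod_sub => _ [e [a [eE aA ->]]].
  rewrite As in aA; move: a aA.
  apply: (@gen_submod_map R (restr M) (restr M) (@gact R Gamma M e^-1%g)) => b bs.
  by apply: mem_gen_submod; apply/allpairsP; exists (e, b).
apply: gen_submod_sub => _ /allpairsP[[e b] /= [eE bs ->]].
by apply: in_translates => //; rewrite As; apply: mem_gen_submod.
Qed.

End Generators.

Section Equality.
Variables (K : realType) (R : pzRingType) (L : lmodType R -> \bar K).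
Hypothesis hL : length_function L.
Variables (Gamma : groupType).
Hypothesis hGamma : amenable K Gamma.
Variables (J : Type) (le : J -> J -> Prop).
Hypothesis hJ : directed le.
Variables (d : J -> nat) (sigma : forall i, Gamma -> 'S_(d i)).
Hypothesis hsigma : sofic_net K le sigma.
Variable omega : set_system J.
Hypothesis homega : free_ultrafilter le omega.
Variable M : lmodType (group_ring R Gamma).
Hypothesis finM : locally_finite L (restr M).

Let omegaU : UltraFilter omega := homega.1.

#[local] Instance omega_proper : ProperFilter omega := @ultra_proper _ _ omegaU.

Let tails_omega : tails le `<=` omega.
Proof. by move=> A [j _ jA]; apply: filterS jA (homega.2 j). Qed.

Let d0 i : 0 < ((d i)%:R : K).
Proof. by rewrite ltr0n (sofic_gt0 hsigma). Qed.

Section Sub.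
Variables (A B : submodClosed (restr M)) (F : {fset Gamma}).
Hypothesis finA : finl L A.

Lemma sofic_averageE i :
  (L (submod (sofic_mod A B F (sigma i))) * ((d i)%:R^-1)%:E)%E =
  (len L (sofic_mod A B F (sigma i)) / (d i)%:R)%:E.
Proof. by rewrite finlE ?EFinM //; apply: finl_sofic_mod. Qed.

Lemma sofic_average_cvg :
  cvg ((L (submod (sofic_mod A B F (sigma i))) * ((d i)%:R^-1)%:E)%E
         @[i --> omega]).
Proof.
under eq_fun do rewrite sofic_averageE.
apply: (ultra_cvg_bounded (a := 0) (b := len L A) omegaU) => i.
rewrite divr_ge0 ?len_ge0 //= ler_pdivrMr // mulrC.
exact: len_sofic_mod_le.
Qed.

Lemma sofic_mL_fin_ge x :
  (\forall i \near omega, x * (d i)%:R <= len L (sofic_mod A B F (sigma i))) ->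
  (x%:E <= sofic_mL_fin L sigma omega A B F)%E.
Proof.
move=> nearx; apply: lime_ge; first exact: sofic_average_cvg.
by apply: filterS nearx => i; rewrite sofic_averageE lee_fin ler_pdivlMr.
Qed.

Lemma sofic_mL_fin_le x :
  (\forall i \near omega, len L (sofic_mod A B F (sigma i)) <= x * (d i)%:R) ->
  (sofic_mL_fin L sigma omega A B F <= x%:E)%E.
Proof.
move=> nearx; apply: lime_le; first exact: sofic_average_cvg.
by apply: filterS nearx => i; rewrite sofic_averageE lee_fin ler_pdivrMr.
Qed.

End Sub.

(** Witnesses for the infimum on the left come from a set [E] that nearly realises
    [mean_length A]: relations along [E] with coefficients in [A^E]. *)
Lemma sofic_mL_subE (A : submodClosed (restr M)) : fin_gen A ->
  sofic_mL_sub L sigma omega A = mL_sub L A.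
Proof.
move=> fgA; have finA : finl L A := finM fgA.
rewrite mL_subE //; apply/eqP; rewrite eq_le; apply/andP; split.
  apply/lee_addgt0Pr => _/posnumP[e]; rewrite [e%:num]splitr; set e2 := _ / 2.
have e20 : 0 < e2 by rewrite divr_gt0.
  have [E [C leE]] := sofic_mod_le_mean hL finA e20.
  apply: ge_ereal_inf; exists (sofic_mL_rel L sigma omega A (translates A E)).
    by exists (translates A E) => //; apply: fin_gen_translates.
  apply: ge_ereal_inf.
  exists (sofic_mL_fin L sigma omega A (translates A E) E); first by exists E.
  rewrite -EFinD; apply: sofic_mL_fin_le => //.
  apply: filterS (near_bad_count hJ hsigma _ tails_omega E C e20) => i lebad.
  apply: le_trans (leE _ _) _; rewrite addrA [leRHS]mulrDl.
  by apply: lerD => //; rewrite mulrC.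
apply/ereal_infP => _ [B fgB <-]; apply/ereal_infP => _ [F _ <-].
have finB : finl L B := finM fgB.
apply/lee_addgt0Pr => _/posnumP[e]; rewrite [e%:num]splitr; set e2 := _ / 2.
have e20 : 0 < e2 by rewrite divr_gt0.
have [H [C leH]] := mean_le_sofic_mod hL hGamma F finA finB e20.
rewrite -leeBlDr // -EFinB; apply: sofic_mL_fin_ge => //.
apply: filterS (near_bad_count hJ hsigma _ tails_omega H C e20) => i lebad.
have := le_trans (leH _ (sigma i)) (lerD (lexx _) lebad).
by rewrite -lerBlDr; apply: le_trans; rewrite opprD addrA mulrBl mulrC.
Qed.

End Equality.

Local Close Scope classical_set_scope.

(** * Submodules over the group ring *)

Section SubmoduleTransfer.
Variables (R : pzRingType) (Gamma : groupType).
Variables (M2 : lmodType (group_ring R Gamma)) (M1 : submodClosed M2).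
Implicit Types (A : submodClosed (restr (submod M1))).

Definition incl (x : restr (submod M1)) : restr M2 := \val (x : submod M1).

Lemma incl_linear : linear incl.
Proof. by []. Qed.

HB.instance Definition _ := GRing.isLinear.Build R (restr (submod M1))
  (restr M2) *:%R incl incl_linear.

Lemma incl_gact s x : incl (gact s x) = gact s (incl x).
Proof. by []. Qed.

Definition image_incl A : submodClosed (restr M2) :=
  image_submod (incl : {linear restr (submod M1) -> restr M2}) A.

Lemma image_inclP A y :
  reflect (exists2 x, x \in A & incl x = y) (y \in image_incl A).
Proof. exact: image_submodP. Qed.

Lemma gen_submod_incl (r : seq (restr (submod M1))) x :
  (incl x \in gen_submod [set` map incl r]%classic) =
  (x \in gen_submod [set` r]%classic).
Proof.
apply/idP/idP => [xr|].
  have sub : subsm (gen_submod [set` map incl r]%classic)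
                   (image_incl (gen_submod [set` r]%classic)).
    apply: gen_submod_sub => _ /mapP[y yr ->]; apply/image_inclP.
    by exists y => //; apply: mem_gen_submod.
  by have /image_inclP[y yr /val_inj <-] := sub _ xr.
move: x; apply: (gen_submod_map (f := @incl)) => y yr.
exact/mem_gen_submod/map_f.
Qed.

Lemma fin_gen_image_incl A : fin_gen A -> fin_gen (image_incl A).
Proof.
move=> [r Ar]; exists (map incl r) => y; apply/idP/idP.
  by move=> /image_inclP[x xA <-]; rewrite gen_submod_incl -Ar.
apply: gen_submod_sub => _ /mapP[x xr ->]; apply/image_inclP; exists x => //.
by rewrite Ar; apply: mem_gen_submod.
Qed.

(** Generators lie in [M1], so they lift one by one. *)
Lemma fin_gen_incl_lift (N : submodClosed (restr M2)) :
  fin_gen N -> (forall x : M2, (x : restr M2) \in N -> x \in M1) ->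
  exists2 A, fin_gen A & image_incl A =i N.
Proof.
move=> [r Nr] NM1.
have [r' r'E] : exists r' : seq (restr (submod M1)), map incl r' = r.
  have rM1 x : x \in r -> (x : M2) \in M1.
    by move=> xr; apply: NM1; rewrite Nr; apply: mem_gen_submod.
  elim: r {Nr} rM1 => [|x r IH] rM1; first by exists [::].
  have [r' r'E] := IH (fun y yr => rM1 y (@mem_behead _ (x :: r) y yr)).
  exists ((exist _ (x : M2) (rM1 x (mem_head _ _)) : restr (submod M1)) :: r').
  by rewrite /= r'E.
exists (gen_submod [set` r']%classic); first by exists r'.
move=> y; apply/image_inclP/idP => [[x xr <-]|yN].
  by rewrite Nr -r'E gen_submod_incl.
have yM1 : (y : M2) \in M1 by apply: NM1.
exists (exist _ (y : M2) yM1) => //.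
by rewrite -gen_submod_incl r'E -Nr.
Qed.

Lemma translates_image_incl A (F : {fset Gamma}) y :
  reflect (exists2 x, x \in translates A F & incl x = y)
          (y \in translates (image_incl A) F).
Proof.
apply: (iffP idP) => [|[x xA <-]].
  suff sub : subsm (translates (image_incl A) F) (image_incl (translates A F)).
    by move=> /sub/image_inclP.
  apply: gen_submod_sub => _ [s [_ [sF /image_inclP[x xA <-] ->]]].
  by apply/image_inclP; exists (gact s^-1%g x); first exact: in_translates.
move: x xA; apply: (gen_submod_map (f := @incl)).
move=> _ [s [a [sF aA ->]]] /=; rewrite incl_gact.
by apply: in_translates => //; apply/image_inclP; exists a.
Qed.

End SubmoduleTransfer.

Section TransferMeanLength.
Variables (K : realType) (R : pzRingType) (L : lmodType R -> \bar K).
Hypothesis hL : length_function L.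
Variables (Gamma : groupType) (M2 : lmodType (group_ring R Gamma)).
Variable M1 : submodClosed M2.

Lemma mL_sub_ext (M : lmodType (group_ring R Gamma))
    (A B : submodClosed (restr M)) : A =i B -> mL_sub L A = mL_sub L B.
Proof.
move=> AB; have eqL F : L (submod (translates A F)) = L (submod (translates B F)).
  apply: (length_ext hL) => x.
  by apply/idP/idP; apply: translates_mono => y; rewrite AB.
by rewrite /mL_sub; under eq_fun do rewrite eqL.
Qed.

Lemma mL_sub_image_incl (A : submodClosed (restr (submod M1))) :
  mL_sub L (image_incl A) = mL_sub L A.
Proof.
have eqL F : L (submod (translates (image_incl A) F)) = L (submod (translates A F)).
  symmetry.
  refine (@length_iso K R L hL (restr (submod M1)) (restr M2)
    (@incl R Gamma M2 M1) _ _ _ _ _).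
  - by move=> x xA; apply/translates_image_incl; exists x.
  - by move=> y /translates_image_incl.
  - by move=> x _ x0; apply: val_inj.
by rewrite /mL_sub; under eq_fun do rewrite eqL.
Qed.

End TransferMeanLength.

Theorem theorem5p1 (K : realType) (R : pzRingType) (L : lmodType R -> \bar K)
    (hL : length_function L)
    (Gamma : groupType) (hGamma : amenable K Gamma)
    (J : Type) (le : J -> J -> Prop) (hJ : directed le)
    (d : J -> nat) (sigma : forall i, Gamma -> 'S_(d i))
    (hsigma : sofic_net K le sigma)
    (omega : set_system J) (homega : free_ultrafilter le omega) :
  (forall M : lmodType (group_ring R Gamma),
     locally_finite L (restr M) ->
     forall A : submodClosed (restr M), fin_gen A ->
       sofic_mL_sub L sigma omega A = mL_sub L A) /\
  (forall (M2 : lmodType (group_ring R Gamma)) (M1 : submodClosed M2),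
     locally_finite L (restr M2) ->
     sofic_mL L sigma omega M1 = mL L (submod M1)).
Proof.
have part1 (M : lmodType (group_ring R Gamma)) (finM : locally_finite L (restr M))
    (A : submodClosed (restr M)) : fin_gen A ->
    sofic_mL_sub L sigma omega A = mL_sub L A.
  exact: (sofic_mL_subE hL hGamma hJ hsigma homega finM).
split=> // M2 M1 finM; rewrite /sofic_mL /mL; congr ereal_sup.
apply/seteqP; split=> l [A].
  move=> [fgA AM1] <-; have [A' fgA' A'A] := fin_gen_incl_lift fgA AM1.
  exists A' => //; rewrite part1 // -mL_sub_image_incl //.
  exact: mL_sub_ext.
move=> fgA <-; exists (image_incl A).
  split; first exact: fin_gen_image_incl.
  by move=> _ /image_inclP[x _ <-]; apply: valP.
by rewrite part1 ?mL_sub_image_incl //; apply: fin_gen_image_incl.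
Qed.
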